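(* Suppose the Lipschitz assumption (with constants $L_G,L_H\in(0,\infty)$) holds. Let $$r(\mu):=128+\frac{12800}{(1-C)^2}+\left(\frac{2\sqrt{2L_G}}{\eta_1}+\frac{L_H^{1/2}}{(1-C)^{1/2}\eta_1^{3/2}}\right)\mu^{-1/2}+\frac{40^{1/5}L_G^{3/5}}{(1-C)^{1/5}\eta_1^{6/5}}\mu^{-3/5}.$$ Then Algorithm A, started at $x_1\in\operatorname{int}\mathcal X$ with barrier parameter $\mu>0$, terminates after at most $$K\le 1+\frac{\psi_\mu(x_1)-\psi_\mu^\star}{C\gamma\mu}\left(\frac{8L_G^{2/3}}{(1-C)^{2/3}\eta_1^{4/3}}\,\mu^{-2/3}+r(\mu)\right)$$ iterations with a $\mu$-approximate first-order stationary interior point.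
   Context: **Problem.** $f:\mathbb R^n\to\mathbb R$ is convex, $a:\mathbb R^n\to\mathbb R^q$ has concave components $a_1,\dots,a_q$, $\mathcal X:=\{x\in\mathbb R^n: a(x)\ge 0\}$, $\operatorname{int}\mathcal X:=\{x: a(x)>0\}$ (componentwise). For $\mu>0$, $\psi_\mu(x):=f(x)-\mu\sum_{i=1}^q\log a_i(x)$, with $\psi_\mu(x)=+\infty$ if some $a_i(x)\le 0$, and $\psi_\mu^\star:=\inf_{x\in\mathcal X}\psi_\mu(x)$. $\mathcal L(x,y):=f(x)-y^\top a(x)$ is the Lagrangian; $\nabla a(x)$ is the $q\times n$ Jacobian; $\mathbf 1$ is the all-ones vector. **Lipschitz assumption.** $f$ and each $a_i$ are thrice differentiable on $\mathbb R^n$ and on $\mathcal X$ each of them has $L_G$-Lipschitz first derivative and $L_H$-Lipschitz second derivative. **Constants.** $C\in(0,1/2)$, $\gamma\in(0,1)$, $\eta_1\in(0,1/2)$, $\eta_2\in(\eta_1,1/2)$ with $2\eta_2+\frac58(1-C)\eta_1\le\sqrt{7/8}$. **$\mu$-approximate first-order stationary interior point (SIP).** A pair $(x,y)$ with $a(x)>0$, $y>0$, $|y_ia_i(x)-\mu|\le\mu/2$ for all $i$, and $\|\nabla_x\mathcal L(x,y)\|_2\le\mu\sqrt{\|y\|_1+1}$. **Algorithm A (fixed barrier parameter).** Input $x_1\in\operatorname{int}\mathcal X$, $\mu>0$. For $k=1,2,\dots$: (I) Put $S_k:=\operatorname{diag}(a(x_k))$, $y_k:=\mu S_k^{-1}\mathbf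 1$, $Y_k:=\operatorname{diag}(y_k)$. If $(x_k,y_k)$ is a $\mu$-approximate SIP, stop and return it. (Step) Let $\varepsilon_k:=\mu\sqrt{1+\|y_k\|_1}$, $\mathcal M_k(d):=\nabla\psi_\mu(x_k)^\top d+\frac12d^\top\nabla^2\psi_\mu(x_k)d$. Choose $\delta_k\ge 0$ and $d^x_k$ with $(\nabla^2\psi_\mu(x_k)+\delta_kI)d^x_k=-\nabla\psi_\mu(x_k)$, $\eta_1\le\frac{-\mathcal M_k(d^x_k)}{\varepsilon_k\|d^x_k\|_2}$, and either $\psi_\mu(x_k+d_k^x)>\psi_\mu(x_k)+C\mathcal M_k(d_k^x)$ or $\frac{\|d^x_k\|_2\delta_k}{2\varepsilon_k}\le\eta_2$. Choose $\alpha_k\in(0,1]$ with $\psi_\mu(x_k+\alpha_kd^x_k)\le\psi_\mu(x_k)+C\mathcal M_k(\alpha_kd^x_k)$ and such that either $\alpha_k=1$ or, with $\hat\alpha_k=\min\{1,\alpha_k/\gamma\}$, $\psi_\mu(x_k+\hat\alpha_kd^x_k)>\psi_\mu(x_k)+C\mathcal M_k(\hat\alpha_kd^x_k)$. Set $x_{k+1}=x_k+\alpha_kd^x_k$. (II) Put $d^s_k:=\nabla a(x_k)d^x_k$, $d^y_k:=-Y_kS_k^{-1}d^s_k$, $\hat y_{k+1}:=y_k+d^y_k$. If $(x_{k+1},\hat y_{k+1})$ is a $\mu$-approximate SIP, stop and return it.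
   Formalization: Termination with a stationary interior point is stated under the added assumption that ψ_μ^⋆ > −∞; without it the bound is infinite and the claim fails, e.g. for f(x) = −x, a(x) = x, μ = 1/2, where no such point exists. *)

(* Defs.v *)
(* MathComp-Analysis development: [R : realType], vectors of R^n are columns
   ['cV[R]_n].  The library's norm on matrices is the max norm, so the Euclidean
   and l1 norms used here are defined explicitly. *)
From HB Require Import structures.
From mathcomp Require Export all_boot all_order all_algebra.
From mathcomp Require Export all_classical all_reals all_analysis.

Set Implicit Arguments.
Unset Strict Implicit.
Unset Printing Implicit Defensive.

Import Order.TTheory GRing.Theory Num.Theory.
Import numFieldNormedType.Exports.

Local Open Scope classical_set_scope.
Local Open Scope ring_scope.

Section Calculus.
Context {R : realType}.

Definition norm2 (m : nat) (v : 'cV[R]_m) : R :=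
  Num.sqrt (\sum_(i < m) v i 0 ^+ 2).

Definition norm1 (m : nat) (v : 'cV[R]_m) : R := \sum_(i < m) `|v i 0|.

Definition opnorm2 (m n : nat) (A : 'M[R]_(m, n)) : R :=
  sup [set norm2 (A *m v) | v in [set v : 'cV[R]_n | norm2 v <= 1]].

Definition dot (m : nat) (u v : 'cV[R]_m) : R := (u^T *m v) 0 0.

Definition grad (n : nat) (g : 'cV[R]_n -> R) (x : 'cV[R]_n) : 'cV[R]_n :=
  \col_(i < n) 'D_(delta_mx i 0) g x.

Definition jac (n q : nat) (h : 'cV[R]_n -> 'cV[R]_q) (x : 'cV[R]_n) :
    'M[R]_(q, n) :=
  \matrix_(i < q, j < n) 'D_(delta_mx j 0) (fun z => h z i 0) x.

Definition hess (n : nat) (g : 'cV[R]_n -> R) (x : 'cV[R]_n) : 'M[R]_n :=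
  jac (grad g) x.

(* [differentiable] is Frechet differentiability at a point. *)
Definition thrice_differentiable (n : nat) (g : 'cV[R]_n -> R) : Prop :=
  [/\ forall x, differentiable g x,
      forall x, differentiable (grad g) x &
      forall x, differentiable (hess g) x].

Definition lipschitz_grad_on (n : nat) (A : set 'cV[R]_n) (L : R)
    (g : 'cV[R]_n -> R) : Prop :=
  forall x y, A x -> A y -> norm2 (grad g x - grad g y) <= L * norm2 (x - y).

Definition lipschitz_hess_on (n : nat) (A : set 'cV[R]_n) (L : R)
    (g : 'cV[R]_n -> R) : Prop :=
  forall x y, A x -> A y -> opnorm2 (hess g x - hess g y) <= L * norm2 (x - y).

End Calculus.

Section BarrierProblem.
Context {R : realType} {n q : nat}.
Variables (f : 'cV[R]_n -> R) (a : 'cV[R]_n -> 'cV[R]_q).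
Implicit Types (x d : 'cV[R]_n) (y : 'cV[R]_q).

Definition convex_problem : Prop :=
  convex_function [set: 'cV[R]_n] f /\
  forall i : 'I_q, convex_function [set: 'cV[R]_n] (fun x => - a x i 0).

Definition feasible : set 'cV[R]_n := [set x | forall i, 0 <= a x i 0].

Definition strictly_feasible : set 'cV[R]_n := [set x | forall i, 0 < a x i 0].

Definition lipschitz_assumption (L_G L_H : R) : Prop :=
  [/\ thrice_differentiable f,
      lipschitz_grad_on feasible L_G f,
      lipschitz_hess_on feasible L_H f &
      forall i : 'I_q,
        [/\ thrice_differentiable (fun x => a x i 0),
            lipschitz_grad_on feasible L_G (fun x => a x i 0) &
            lipschitz_hess_on feasible L_H (fun x => a x i 0)]].

(* The finite part of the barrier function; its derivatives are taken only at
   strictly feasible points, near which it coincides with [psi]. *)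
Definition psi_fin (mu : R) x : R := f x - mu * \sum_(i < q) ln (a x i 0).

Definition psi (mu : R) x : \bar R :=
  if [forall i, 0 < a x i 0] then (psi_fin mu x)%:E else +oo%E.

Definition psi_star (mu : R) : \bar R := ereal_inf (psi mu @` feasible).

Definition lagrangian x y : R := f x - dot y (a x).

Definition mu_SIP (mu : R) x y : Prop :=
  [/\ forall i, 0 < a x i 0,
      forall i, 0 < y i 0,
      forall i, `|y i 0 * a x i 0 - mu| <= mu / 2 &
      norm2 (grad (fun z => lagrangian z y) x)
        <= mu * Num.sqrt (norm1 y + 1)].

End BarrierProblem.

Section Algorithm.
Context {R : realType} {n q : nat}.
Variables (f : 'cV[R]_n -> R) (a : 'cV[R]_n -> 'cV[R]_q).
Variables (C gamma eta1 eta2 mu : R).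
Implicit Types (x d : 'cV[R]_n).

Definition slack_mx x : 'M[R]_q := diag_mx (a x)^T.

Definition dual_var x : 'cV[R]_q := mu *: (invmx (slack_mx x) *m const_mx 1).

Definition dual_mx x : 'M[R]_q := diag_mx (dual_var x)^T.

Definition eps x : R := mu * Num.sqrt (1 + norm1 (dual_var x)).

Definition model x d : R :=
  dot (grad (psi_fin f a mu) x) d
  + 2^-1 * dot d (hess (psi_fin f a mu) x *m d).

Definition sufficient_decrease x d : Prop :=
  (psi f a mu (x + d) <= psi f a mu x + (C * model x d)%:E)%E.

Definition insufficient_decrease x d : Prop :=
  (psi f a mu x + (C * model x d)%:E < psi f a mu (x + d))%E.

(* Since [r / 0 = 0] and [0 < eta1], the quotient condition forces [d != 0]. *)
Definition direction_choice x (delta : R) d : Prop :=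
  [/\ 0 <= delta,
      (hess (psi_fin f a mu) x + delta%:M) *m d = - grad (psi_fin f a mu) x,
      eta1 <= (- model x d) / (eps x * norm2 d) &
      insufficient_decrease x d \/
        (norm2 d * delta) / (2 * eps x) <= eta2].

Definition stepsize_choice x d (alpha : R) : Prop :=
  [/\ 0 < alpha <= 1,
      sufficient_decrease x (alpha *: d) &
      alpha = 1 \/
        insufficient_decrease x (Num.min 1 (alpha / gamma) *: d)].

Definition dual_trial x d : 'cV[R]_q :=
  dual_var x - dual_mx x *m invmx (slack_mx x) *m (jac a x *m d).

Definition stop_I x : Prop := mu_SIP f a mu x (dual_var x).

Definition stop_II x d xnext : Prop := mu_SIP f a mu xnext (dual_trial x d).

(* A run is given by the sequences of iterates and choices, indexed from 1 (the
   values at index 0, and those after the algorithm has stopped, are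
   irrelevant).  Iteration [K] is entered when no iteration before it stopped. *)
Definition entered (x d : nat -> 'cV[R]_n) (K : nat) : Prop :=
  forall k, (0 < k < K)%N ->
    ~ stop_I (x k) /\ ~ stop_II (x k) (d k) (x k.+1).

Definition is_run (x1 : 'cV[R]_n) (x d : nat -> 'cV[R]_n)
    (delta alpha : nat -> R) : Prop :=
  x 1%N = x1 /\
  forall k, (0 < k)%N -> entered x d k -> ~ stop_I (x k) ->
    [/\ direction_choice (x k) (delta k) (d k),
        stepsize_choice (x k) (d k) (alpha k) &
        x k.+1 = x k + alpha k *: d k].

Definition returns_at (x d : nat -> 'cV[R]_n) (K : nat)
    (xr : 'cV[R]_n) (yr : 'cV[R]_q) : Prop :=
  [/\ (0 < K)%N, entered x d K &
      [/\ stop_I (x K), xr = x K & yr = dual_var (x K)] \/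
      [/\ ~ stop_I (x K), stop_II (x K) (d K) (x K.+1),
          xr = x K.+1 & yr = dual_trial (x K) (d K)]].

End Algorithm.

Section Bound.
Context {R : realType} {n q : nat}.

Definition rate_remainder (C eta1 L_G L_H mu : R) : R :=
  128 + 12800 / (1 - C) ^+ 2
  + (2 * Num.sqrt (2 * L_G) / eta1
     + L_H `^ (1 / 2) / ((1 - C) `^ (1 / 2) * eta1 `^ (3 / 2)))
    * mu `^ (- (1 / 2))
  + 40 `^ (1 / 5) * L_G `^ (3 / 5)
    / ((1 - C) `^ (1 / 5) * eta1 `^ (6 / 5)) * mu `^ (- (3 / 5)).

(* Extended real: equal to +oo when the barrier problem is unbounded below. *)
Definition iteration_bound (f : 'cV[R]_n -> R) (a : 'cV[R]_n -> 'cV[R]_q)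
    (C gamma eta1 L_G L_H mu : R) (x1 : 'cV[R]_n) : \bar R :=
  (1%:E + (psi f a mu x1 - psi_star f a mu) / (C * gamma * mu)%:E
    * (8 * L_G `^ (2 / 3) / ((1 - C) `^ (2 / 3) * eta1 `^ (4 / 3))
         * mu `^ (- (2 / 3))
       + rate_remainder C eta1 L_G L_H mu)%:E)%E.

End Bound.

(* Main.v *)
Require Import Defs.
From mathcomp Require Import ring lra.

Set Implicit Arguments.
Unset Strict Implicit.
Unset Printing Implicit Defensive.

Import Order.TTheory GRing.Theory Num.Theory.
Import numFieldNormedType.Exports.

Local Open Scope classical_set_scope.
Local Open Scope ring_scope.

(** Why the bound holds.  Fix an iteration at a strictly feasible [x], with
    multipliers [y_i = mu / a_i x], weight [E = 1 + |y|_1] and direction [d], and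
    let [D = - model x d] be the decrease that the quadratic model predicts.
    Everything is measured by [Z = t * D / mu], where [t] is a fraction of the
    step.  Two facts make [Z] control the trial displacement [u = t d]:

    - the direction test gives [eta1 * sqrt E * |u| <= Z];
    - by convexity the Hessian of the barrier dominates its rank-one part, so the
      relative slopes [p_i = <u, grad a_i x> / a_i x] satisfy
      [\sum_i p_i ^ 2 <= 2 Z] ([slopes_le_hess]).

    The complexity bound multiplies [(psi x1 - psi^star) / (C gamma mu)] by a
    budget [B].  If [Z * B <= 1], then with [s = sqrt (2 Z)] the summands of [B]
    turn into three smallness conditions ([budget_LG], [budget_s], [budget_LH]):
    [8 L_G s^3], [80 s] and [L_H Z^2] are small compared with the data.  Under
    these conditions a displacement is harmless in two senses.

    - It stays strictly feasible, and the third order error of the model of the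
      barrier function is at most [(1 - C) mu Z] ([model_error_le]).  Since the
      model decreases by at least [mu Z] along [u], the sufficient decrease
      condition holds at [u] ([short_step_sufficient]).
    - If [t = 1], a first order expansion of the gradient of the Lagrangian,
      together with the Newton equation, shows that the pair formed by [x + d]
      and the linearised multipliers is an approximate stationary interior point
      ([full_step_SIP]).  The multipliers keep at least 7/8 of their size,
      hence the constant [sqrt (7/8)].

    Consequently an iteration that does not stop has [alpha * D * B >= gamma * mu]
    ([step_progress]): either a trial step, longer than the accepted one by a factor
    at most [1 / gamma], was rejected, and [Z] cannot be small there; or the full
    step was accepted, and a small [Z] would have triggered the second stopping
    test.  So each such iteration decreases the barrier function by at least
    [C gamma mu / B] ([iteration_decrease]); summing these decreases down to
    [psi^star] bounds the number of iterations. *)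

(** * Euclidean norm and operator norm *)

Section Euclidean.
Context {R : realType}.
Implicit Types m n : nat.

Lemma dotE m (u v : 'cV[R]_m) : dot u v = \sum_i u i 0 * v i 0.
Proof. by rewrite /dot mxE; apply: eq_bigr => i _; rewrite mxE. Qed.

Lemma dotC m (u v : 'cV[R]_m) : dot u v = dot v u.
Proof. by rewrite !dotE; apply: eq_bigr => i _; rewrite mulrC. Qed.

Lemma dotDr m (w u v : 'cV[R]_m) : dot w (u + v) = dot w u + dot w v.
Proof. by rewrite /dot mulmxDr mxE. Qed.

Lemma dotZr m (w u : 'cV[R]_m) k : dot w (k *: u) = k * dot w u.
Proof. by rewrite /dot -scalemxAr mxE. Qed.

Lemma dotNr m (w u : 'cV[R]_m) : dot w (- u) = - dot w u.
Proof. by rewrite -scaleN1r dotZr mulN1r. Qed.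

Lemma dotBr m (w u v : 'cV[R]_m) : dot w (u - v) = dot w u - dot w v.
Proof. by rewrite dotDr dotNr. Qed.

Lemma dot_sumr m (I : finType) (w : 'cV[R]_m) (F : I -> 'cV[R]_m) :
  dot w (\sum_i F i) = \sum_i dot w (F i).
Proof.
rewrite dotE; under eq_bigr do rewrite summxE big_distrr /=.
by rewrite exchange_big; apply: eq_bigr => i _; rewrite dotE.
Qed.

Lemma norm2_ge0 m (v : 'cV[R]_m) : 0 <= norm2 v.
Proof. exact: sqrtr_ge0. Qed.

Lemma norm2_sqr m (v : 'cV[R]_m) : norm2 v ^+ 2 = dot v v.
Proof.
rewrite sqr_sqrtr ?sumr_ge0 // => [|i _]; last exact: sqr_ge0.
by rewrite dotE; apply: eq_bigr => i _; rewrite expr2.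
Qed.

Lemma norm2Z m k (v : 'cV[R]_m) : 0 <= k -> norm2 (k *: v) = k * norm2 v.
Proof.
move=> k0; apply/eqP; rewrite -(@eqrXn2 _ 2) ?norm2_ge0 ?mulr_ge0 ?norm2_ge0 //.
by rewrite exprMn !norm2_sqr dotZr dotC dotZr expr2 mulrA.
Qed.

Lemma norm2N m (v : 'cV[R]_m) : norm2 (- v) = norm2 v.
Proof.
by rewrite /norm2; congr Num.sqrt; apply: eq_bigr => i _; rewrite mxE sqrrN.
Qed.

Lemma norm2_eq0 m (v : 'cV[R]_m) : norm2 v = 0 -> v = 0.
Proof.
move=> v0; have := norm2_sqr v; rewrite v0 expr0n /= dotE => /esym/eqP.
rewrite psumr_eq0 => [/allP vi0|i _]; last by rewrite -expr2 sqr_ge0.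
apply/colP => i; rewrite mxE.
by have := vi0 i (mem_index_enum _); rewrite mulf_eq0 orbb => /eqP.
Qed.

(** Cauchy-Schwarz, from the square of the norm of [|v| u - |u| v]. *)
Lemma dot_le m (u v : 'cV[R]_m) : dot u v <= norm2 u * norm2 v.
Proof.
have [/norm2_eq0 ->|u0] := eqVneq (norm2 u) 0.
  by rewrite dotC -[X in dot v X](scale0r u) dotZr mul0r mulr_ge0 ?norm2_ge0.
have [/norm2_eq0 ->|v0] := eqVneq (norm2 v) 0.
  by rewrite -[X in dot u X](scale0r u) dotZr mul0r mulr_ge0 ?norm2_ge0.
have up : 0 < norm2 u by rewrite lt_def u0 norm2_ge0.
have vp : 0 < norm2 v by rewrite lt_def v0 norm2_ge0.
have := sqr_ge0 (norm2 (norm2 v *: u - norm2 u *: v)).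
rewrite norm2_sqr dotBr 2!(dotC (_ - _)) !dotBr !dotZr !(dotC (_ *: _)) !dotZr.
rewrite -!norm2_sqr (dotC v u) => H.
by rewrite -(ler_pM2l (mulr_gt0 up vp)); nra.
Qed.

Lemma abs_dot_le m (u v : 'cV[R]_m) : `|dot u v| <= norm2 u * norm2 v.
Proof. by rewrite ler_norml lerNl -dotNr -{1}(norm2N v) !dot_le. Qed.

(** Take [w = v].  Bounds on vectors thereby become bounds on scalar products,
    where sums over the constraints are sums of numbers. *)
Lemma norm2_le_dual m (v : 'cV[R]_m) B :
  0 <= B -> (forall w, dot w v <= B * norm2 w) -> norm2 v <= B.
Proof.
move=> B0 /(_ v); rewrite -norm2_sqr expr2.
have [->//|v0] := eqVneq (norm2 v) 0.
by rewrite ler_pM2r // lt_def v0 norm2_ge0.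
Qed.

(** A crude bound by the norms of the rows; it shows that the supremum defining
    [opnorm2] is taken over a bounded set. *)
Lemma norm2_mulmx_bound m n (A : 'M[R]_(m, n)) :
  exists2 B, 0 <= B & forall v, norm2 (A *m v) <= B * norm2 v.
Proof.
exists (\sum_i norm2 (row i A)^T) => [|v].
  by apply: sumr_ge0 => i _; exact: norm2_ge0.
apply: norm2_le_dual => [|w].
  by rewrite mulr_ge0 ?norm2_ge0 // sumr_ge0 // => i _; exact: norm2_ge0.
rewrite dotE -mulrA big_distrl /=; apply: ler_sum => i _.
have -> : (A *m v) i 0 = dot (row i A)^T v.
  by rewrite dotE mxE; apply: eq_bigr => j _; rewrite !mxE.
have wi : `|w i 0| <= norm2 w.
  rewrite -[leLHS]ger0_norm // -sqrtr_sqr /norm2 ler_wsqrtr // real_normK ?num_real //.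
  by rewrite (bigD1 i) //= lerDl sumr_ge0 // => j _; exact: sqr_ge0.
apply: le_trans (ler_norm _) _; rewrite normrM [leRHS]mulrA [leRHS]mulrC.
apply: ler_pM => //; exact: abs_dot_le.
Qed.

Lemma opnorm2_le m n (A : 'M[R]_(m, n)) v :
  norm2 (A *m v) <= opnorm2 A * norm2 v.
Proof.
have [B B0 AB] := norm2_mulmx_bound A.
have [v0|v0] := eqVneq (norm2 v) 0; first by rewrite (le_trans (AB v)) // v0 !mulr0.
have vp : 0 < norm2 v by rewrite lt_def v0 norm2_ge0.
have vv : v = norm2 v *: ((norm2 v)^-1 *: v) by rewrite scalerA divff // scale1r.
have n1 : norm2 ((norm2 v)^-1 *: v) = 1 by rewrite norm2Z ?invr_ge0 ?norm2_ge0 // mulVf.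
rewrite {1}vv -scalemxAr norm2Z ?norm2_ge0 // mulrC ler_pM2r //.
apply: ub_le_sup; last by exists ((norm2 v)^-1 *: v) => //=; rewrite n1.
exists B => _ [w /= w1 <-]; apply: le_trans (AB w) _.
by rewrite -[leRHS]mulr1 ler_wpM2l.
Qed.

Lemma dot_mulmx_le n (A : 'M[R]_n) u v :
  `|dot u (A *m v)| <= opnorm2 A * norm2 v * norm2 u.
Proof.
apply: le_trans (abs_dot_le _ _) _; rewrite mulrC.
by rewrite ler_wpM2r ?norm2_ge0 // opnorm2_le.
Qed.

End Euclidean.

(** * Taylor expansions along a segment *)

Section Growth.
Context {R : realType}.

(** The mean value theorem for [g - f]; all Taylor estimates below integrate a bound
    on a derivative through it. *)
Lemma growth_le (f g df dg : R -> R) (t : R) : 0 <= t ->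
  (forall s : R, 0 <= s <= t -> is_derive s 1 f (df s)) ->
  (forall s : R, 0 <= s <= t -> is_derive s 1 g (dg s)) ->
  (forall s : R, 0 <= s <= t -> df s <= dg s) ->
  f t - f 0 <= g t - g 0.
Proof.
move=> t0 fD gD fg.
have hD (s : R) : 0 <= s <= t -> is_derive s 1 (g - f) (dg s - df s).
  by move=> st; apply: is_deriveB; [exact: gD|exact: fD].
have [||c] := @MVT_segment _ (g - f) (fun s => dg s - df s) _ _ t0.
- move=> s; rewrite in_itv /= => /andP[s0 st]; apply: hD.
  by rewrite !ltW.
- apply: derivable_within_continuous => s; rewrite in_itv /= => st.
  by have [] := hD s st.
rewrite in_itv /= subr0 => ct e.
have : 0 <= (g - f) t - (g - f) 0 by rewrite e mulr_ge0 // subr_ge0 fg.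
by rewrite -[(g - f) t]/(g t - f t) -[(g - f) 0]/(g 0 - f 0); lra.
Qed.

Lemma abs_growth_le (f g df dg : R -> R) (t : R) : 0 <= t ->
  (forall s : R, 0 <= s <= t -> is_derive s 1 f (df s)) ->
  (forall s : R, 0 <= s <= t -> is_derive s 1 g (dg s)) ->
  (forall s : R, 0 <= s <= t -> `|df s| <= dg s) ->
  `|f t - f 0| <= g t - g 0.
Proof.
move=> t0 fD gD fg; rewrite ler_norml; apply/andP; split.
  have := @growth_le (- g) f (fun s => - dg s) df t t0
    (fun s st => is_deriveN (gD s st)) fD.
  rewrite -[(- g) t]/(- g t) -[(- g) 0]/(- g 0) opprK opprB [leRHS]addrC.
  rewrite [- g t + _]addrC [leRHS]addrC; apply => s /fg.
  by rewrite ler_norml => /andP[].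
apply: (growth_le t0 fD gD) => s /fg.
by rewrite ler_norml => /andP[].
Qed.

Lemma is_derive_monomial (k : R) m (s : R) :
  is_derive s 1 (fun t : R => k * t ^+ m.+1) (k * m.+1%:R * s ^+ m).
Proof.
have -> : (fun t : R => k * t ^+ m.+1) = k \*: (id ^+ m.+1).
  by apply/funext => t; rewrite -[RHS]/(k * (id ^+ m.+1) t) exprfctE.
apply: is_derive_eq.
by rewrite /GRing.scale /= mulr1 -mulr_natl mulrA.
Qed.

End Growth.

Section Lines.
Context {R : realType} {n : nat}.
Implicit Types (g : 'cV[R]_n -> R) (x u w : 'cV[R]_n).

Lemma cV_basis u : u = \sum_i u i 0 *: delta_mx i 0.
Proof.
apply/colP => j; rewrite summxE (bigD1 j) //= !mxE !eqxx mulr1 big1 ?addr0 //.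
by move=> i ij; rewrite !mxE eq_sym (negPf ij) mulr0.
Qed.

Lemma derive_grad g x u : differentiable g x -> 'D_u g x = dot (grad g x) u.
Proof.
move=> gx; rewrite deriveE // [in LHS](cV_basis u) linear_sum dotE.
apply: eq_bigr => i _; rewrite linearZ mxE deriveE // mulrC.
by [].
Qed.

Lemma is_derive_line g x u t : differentiable g (x + t *: u) ->
  is_derive t 1 (fun s => g (x + s *: u)) (dot (grad g (x + t *: u)) u).
Proof.
move=> gx; rewrite -derive_grad //.
have e : (fun h : R => h^-1 *: (g (x + (h *: 1 + t) *: u) - g (x + t *: u)))
       = (fun h => h^-1 *: (g (h *: u + (x + t *: u)) - g (x + t *: u))).
  apply/funext => h; congr (_ *: (g _ - _)).
  by rewrite -[h *: 1]/(h * 1) mulr1 scalerDl addrCA.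
have gu : derivable g (x + t *: u) u by exact: diff_derivable.
split; first by rewrite /derivable e.
by rewrite /derive e.
Qed.

Lemma differentiable_grad_coord g x i : differentiable (grad g) x ->
  differentiable (fun z => grad g z i 0) x.
Proof.
move=> gx.
exact: (differentiable_comp gx (differentiable_coord _ _ _)).
Qed.

Lemma hess_mulmx g x u i :
  (hess g x *m u) i 0 = dot (grad (fun z => grad g z i 0) x) u.
Proof. by rewrite mxE dotE; apply: eq_bigr => j _; rewrite !mxE. Qed.

Lemma is_derive_grad_line g x u w t : differentiable (grad g) (x + t *: u) ->
  is_derive t 1 (fun s => dot w (grad g (x + s *: u)))
    (dot w (hess g (x + t *: u) *m u)).
Proof.
move=> gx.
have H i : is_derive t 1 (w i 0 \*: (fun s : R => grad g (x + s *: u) i 0))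
   (w i 0 *: ((hess g (x + t *: u) *m u) i 0)).
  apply: is_deriveZ; rewrite hess_mulmx.
  exact: is_derive_line (differentiable_grad_coord _ gx).
have := is_derive_sum H; rewrite -dotE.
congr (is_derive _ _ _ _); apply/funext => s.
by rewrite fct_sumE dotE.
Qed.

Variables (A : set 'cV[R]_n) (L : R) (x u : 'cV[R]_n).
Hypothesis xuA : forall t : R, 0 <= t <= 1 -> A (x + t *: u).

Let xA : A x.
Proof. by have := @xuA 0; rewrite scale0r addr0; apply; rewrite lexx ler01. Qed.

(** The derivative of the left-hand side at [s] is
    [<w, (hess g (x + s u) - hess g x) u>], of size at most [L s |u|^2 |w|]. *)
Lemma grad_taylor2 g w (t : R) :
  (forall z, differentiable (grad g) z) -> lipschitz_hess_on A L g ->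
  0 <= t <= 1 ->
  `|dot w (grad g (x + t *: u)) - dot w (grad g x) - t * dot w (hess g x *m u)|
    <= L / 2 * norm2 u ^+ 2 * norm2 w * t ^+ 2.
Proof.
move=> gD gL /andP[t0 t1].
pose c := dot w (hess g x *m u).
have fD (s : R) : 0 <= s <= t -> is_derive s 1
    ((fun s => dot w (grad g (x + s *: u))) - (fun s => c * s ^+ 1))
    (dot w (hess g (x + s *: u) *m u) - c * 1 * s ^+ 0).
  move=> _; apply: is_deriveB (is_derive_monomial c 0 s).
  exact: is_derive_grad_line.
pose k := L / 2 * norm2 u ^+ 2 * norm2 w.
have := abs_growth_le t0 fD (fun s _ => is_derive_monomial k 1 s).
rewrite !fctE scale0r addr0 !expr0n /= !expr1 !mulr0 !subr0 => H.
rewrite addrAC [t * _]mulrC; apply: H => s /andP[s0 st].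
rewrite expr0 !mulr1 -dotBr -mulmxBl; apply: le_trans (dot_mulmx_le _ _ _) _.
have -> : k * 2%:R * s = L * (s * norm2 u) * norm2 u * norm2 w.
  by rewrite /k; field.
rewrite !ler_wpM2r ?norm2_ge0 // -norm2Z // -[X in _ <= _ * norm2 X](addKr x).
rewrite [- x + _]addrC; apply: gL => //.
by apply: xuA; rewrite s0 (le_trans st).
Qed.

Lemma value_taylor1 g (t : R) :
  (forall z, differentiable g z) -> lipschitz_grad_on A L g ->
  0 <= t <= 1 ->
  `|g (x + t *: u) - g x - t * dot (grad g x) u|
    <= L / 2 * norm2 u ^+ 2 * t ^+ 2.
Proof.
move=> gD gL /andP[t0 t1].
pose c := dot (grad g x) u.
have fD (s : R) : 0 <= s <= t -> is_derive s 1
    ((fun s => g (x + s *: u)) - (fun s => c * s ^+ 1))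
    (dot (grad g (x + s *: u)) u - c * 1 * s ^+ 0).
  move=> _; apply: is_deriveB (is_derive_monomial c 0 s).
  exact: is_derive_line.
pose k := L / 2 * norm2 u ^+ 2.
have := abs_growth_le t0 fD (fun s _ => is_derive_monomial k 1 s).
rewrite !fctE scale0r addr0 !expr0n /= !expr1 !mulr0 !subr0 => H.
rewrite addrAC [t * _]mulrC; apply: H => s /andP[s0 st].
rewrite expr0 !mulr1 /c !(dotC _ u) -dotBr.
apply: le_trans (abs_dot_le _ _) _.
have -> : k * 2%:R * s = norm2 u * (L * (s * norm2 u)).
  by rewrite /k; field.
rewrite ler_wpM2l ?norm2_ge0 // -norm2Z // -[X in _ <= _ * norm2 X](addKr x).
rewrite [- x + _]addrC; apply: gL => //.
by apply: xuA; rewrite s0 (le_trans st).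
Qed.

(** Integrates [grad_taylor2] taken at [w = u]. *)
Lemma value_taylor2 g (t : R) :
  (forall z, differentiable g z) -> (forall z, differentiable (grad g) z) ->
  lipschitz_hess_on A L g -> 0 <= t <= 1 ->
  `|g (x + t *: u) - g x - t * dot (grad g x) u
     - t ^+ 2 / 2 * dot u (hess g x *m u)|
    <= L / 6 * norm2 u ^+ 3 * t ^+ 3.
Proof.
move=> gD g2D gL /andP[t0 t1].
pose c := dot (grad g x) u; pose b := dot u (hess g x *m u) / 2.
have fD (s : R) : 0 <= s <= t -> is_derive s 1
    ((fun s => g (x + s *: u)) - (fun s => c * s ^+ 1) - (fun s => b * s ^+ 2))
    (dot (grad g (x + s *: u)) u - c * 1 * s ^+ 0 - b * 2 * s ^+ 1).
  move=> _; apply: is_deriveB (is_derive_monomial b 1 s).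
  apply: is_deriveB (is_derive_monomial c 0 s).
  exact: is_derive_line.
pose k := L / 6 * norm2 u ^+ 3.
have := abs_growth_le t0 fD (fun s _ => is_derive_monomial k 2 s).
rewrite !fctE scale0r addr0 !expr0n /= !expr1 !mulr0 !subr0 => H.
have -> : g (x + t *: u) - g x - t * dot (grad g x) u
  - t ^+ 2 / 2 * dot u (hess g x *m u)
  = g (x + t *: u) - c * t - b * t ^+ 2 - g x by rewrite /c /b; field.
apply: H => s /andP[s0 st]; rewrite expr0 !mulr1 /c !(dotC _ u).
have -> : b * 2 * s = s * dot u (hess g x *m u) by rewrite /b; field.
apply: le_trans (grad_taylor2 u g2D gL _) _; first by rewrite s0 (le_trans st).
by rewrite le_eqVlt; apply/orP; left; apply/eqP; rewrite /k; field.
Qed.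

End Lines.

(** * Convexity, feasibility of segments, and the logarithm *)

Section Convex.
Context {R : realType} {n : nat}.
Implicit Types (g : 'cV[R]_n -> R) (x u : 'cV[R]_n).

Lemma convex_function_le g x y (t : R) : convex_function [set: 'cV[R]_n] g ->
  0 <= t <= 1 -> g (t *: x + (1 - t) *: y) <= t * g x + (1 - t) * g y.
Proof.
move=> gc /andP[t0 t1].
by have := gc (Itv01 t0 t1) x y; rewrite !inE => /(_ I I).
Qed.

(** A negative difference quotient of the derivative around [0] puts the function
    strictly below its tangent on both sides of [0]. *)
Lemma decreasing_derivative_midpoint (phi G : R -> R) (e : R) : 0 < e ->
  (forall s : R, is_derive s 1 phi (G s)) ->
  (forall h, h != 0 -> `|h| < e -> h^-1 * (G h - G 0) < 0) ->
  exists h : R, phi h + phi (- h) < 2 * phi 0.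
Proof.
move=> e0 phiD slope.
have phiC (a b : R) : {within `[a, b], continuous phi}.
  by apply: derivable_within_continuous => s _; have [] := phiD s.
pose h := e / 2.
have h0 : 0 < h by rewrite divr_gt0.
have [c ch Hc] := MVT h0 (fun s _ => phiD s) (phiC _ _).
have Nh0 : - h < 0 by rewrite oppr_lt0.
have [b bh Hb] := MVT Nh0 (fun s _ => phiD s) (phiC _ _).
have he : h < e by rewrite /h ltr_pdivrMr // ltr_pMr // ltr1n.
exists h; move: ch bh; rewrite !in_itv /= => /andP[c1 c2] /andP[b1 b2].
have Gc : G c < G 0.
  have := slope c (lt0r_neq0 c1); rewrite gtr0_norm // => /(_ (lt_trans c2 he)).
  by rewrite pmulr_rlt0 ?invr_gt0 // subr_lt0.
have Gb : G 0 < G b.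
  have nbe : - b < e by rewrite (lt_trans _ he) // ltrNl.
  have := slope b (ltr0_neq0 b2); rewrite ltr0_norm // => /(_ nbe).
  by rewrite nmulr_rlt0 ?invr_lt0 // subr_gt0.
move: Hc Hb; rewrite subr0 sub0r opprK => Hc Hb.
have {}Hc : phi h - phi 0 < G 0 * h by rewrite Hc ltr_pM2r.
have {}Hb : G 0 * h < phi 0 - phi (- h) by rewrite Hb ltr_pM2r.
by lra.
Qed.

(** A negative second derivative along a line would contradict midpoint convexity
    near [x]. *)
Lemma convex_hess_ge0 g x u : convex_function [set: 'cV[R]_n] g ->
  (forall z, differentiable g z) -> differentiable (grad g) x ->
  0 <= dot u (hess g x *m u).
Proof.
move=> gc gD g2D; rewrite leNgt; apply/negP => c0.
have g2D' : differentiable (grad g) (x + 0 *: u) by rewrite scale0r addr0.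
have [Gder Gval] := is_derive_grad_line u g2D'.
have [e e0 He] : exists2 e : R, 0 < e & forall h, h != 0 -> `|h| < e ->
    h^-1 * (dot u (grad g (x + h *: u)) - dot u (grad g (x + 0 *: u))) < 0.
  move: Gval; rewrite /derive => Gval.
  have := Gder; rewrite /derivable Gval scale0r addr0.
  move=> /(cvgr_lt _) /(_ 0 c0) /nbhs_ballP [e /= e0 He].
  exists e => // h h0 he.
  have := He h; rewrite /= /ball /= sub0r normrN => /(_ he h0).
  by rewrite -[h *: 1]/(h * 1) !(mulr1, scale0r, addr0).
have phiD (s : R) : is_derive s 1 (fun s => g (x + s *: u))
    (dot u (grad g (x + s *: u))) by rewrite dotC; apply: is_derive_line; exact: gD.
have [h] := decreasing_derivative_midpoint e0 phiD He.
have half : 0 <= (2^-1 : R) <= 1.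
  by rewrite invr_ge0 ler0n invf_le1 ?ler1n.
have := convex_function_le (x + h *: u) (x + (- h) *: u) gc half.
have h2 : (1 - 2^-1 : R) = 2^-1 by rewrite {1}[1]splitr div1r addrK.
have -> : 2^-1 *: (x + h *: u) + (1 - 2^-1) *: (x + (- h) *: u) = x + 0 *: u.
  by apply/colP => i; rewrite !mxE; field.
rewrite h2 -mulrDr ler_pdivlMl // => H.
by rewrite ltNge H.
Qed.

Lemma concave_segment_ge g x u (h t s : R) :
  convex_function [set: 'cV[R]_n] (fun z => - g z) ->
  h <= g x -> h <= g (x + t *: u) -> 0 <= s <= t -> h <= g (x + s *: u).
Proof.
move=> gc hx ht /andP[s0 st].
have [t0|t0] := eqVneq t 0.
  have -> : s = 0 by apply/eqP; rewrite eq_le s0 -t0 st.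
  by rewrite scale0r addr0.
have tp : 0 < t by rewrite lt_def t0 (le_trans s0).
have l01 : 0 <= s / t <= 1 by rewrite divr_ge0 ?(ltW tp) // ler_pdivrMr // mul1r.
have := convex_function_le (x + t *: u) x gc l01.
have -> : (s / t) *: (x + t *: u) + (1 - s / t) *: x = x + s *: u.
  by rewrite scalerDr scalerA divfK // addrAC -scalerDl subrKC scale1r.
case/andP: l01; move: hx ht; move: (g x) (g (x + t *: u)) (g _) (s / t) => p pt ps l; nra.
Qed.

Variables (q : nat) (a : 'cV[R]_n -> 'cV[R]_q).
Hypothesis a_concave :
  forall i, convex_function [set: 'cV[R]_n] (fun z => - a z i 0).
Hypothesis a_diff : forall i z, differentiable (fun z => a z i 0) z.

(** The Lipschitz bounds hold on the feasible set only, so they can be used up to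
    the parameter [t] only once the segment is known to be feasible up to [t].  The
    premise says that every such use keeps the slacks above half of their initial
    values.  Then no constraint can be the first one to lose half of its value,
    so none does.  Concavity reduces feasibility of a segment to its endpoints. *)
Lemma strictly_feasible_segment x u : strictly_feasible a x ->
  (forall t : R, 0 <= t <= 1 ->
    (forall s : R, 0 <= s <= t -> feasible a (x + s *: u)) ->
    forall i, a x i 0 < 2 * a (x + t *: u) i 0) ->
  forall t : R, 0 <= t <= 1 -> strictly_feasible a (x + t *: u).
Proof.
move=> x_in step.
pose P i := a (x + 1 *: u) i 0 < a x i 0 / 2.
have a2 i : a x i 0 / 2 <= a x i 0 by have := x_in i; lra.
(* when the slack has lost half of its value, or [1] if it never does *)
have hit i : exists t : R, [/\ 0 <= t <= 1, a x i 0 / 2 <= a (x + t *: u) i 0,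
    P i -> a (x + t *: u) i 0 = a x i 0 / 2 & ~~ P i -> t = 1].
  case: (boolP (P i)) => [Pi|]; last first.
    by rewrite -leNgt => nPi; exists 1; split=> //; rewrite ler01 lexx.
  have [||t] := @IVT R (fun t => a (x + t *: u) i 0) 0 1 (a x i 0 / 2) ler01.
  - apply: derivable_within_continuous => s _.
    by have [] := is_derive_line (a_diff i (x + s *: u)).
  - by rewrite scale0r addr0 ge_min le_max (ltW Pi) a2 orbT.
  by rewrite in_itv /= => t01 e; exists t; split; rewrite ?e.
have [tau tauP] := choice hit.
have allN i : ~~ P i.
  apply/negP => Pi.
  (* the constraint that is the first to lose half of its initial value *)
  case: (arg_minP tau Pi) => j Pj jmin.
  have [j01 _ /(_ Pj) aj _] := tauP j.
  have stay k (s : R) : 0 <= s <= tau j -> a x k 0 / 2 <= a (x + s *: u) k 0.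
    move=> /andP[s0 st]; have [_ tk _ kN] := tauP k.
    apply: (concave_segment_ge (a_concave k) (a2 k) tk); rewrite s0.
    have [/jmin|/kN ->] := boolP (P k); first exact: le_trans.
    by rewrite (le_trans st) //; case/andP: j01.
  have /(step _ j01)/(_ j) : forall s : R, 0 <= s <= tau j ->
      feasible a (x + s *: u).
    by move=> s sj k; apply: le_trans (stay k s sj); rewrite divr_ge0 // ltW.
  by rewrite aj mulrC divfK ?pnatr_eq0 // ltxx.
move=> t t01 i.
have ai : a x i 0 / 2 <= a (x + 1 *: u) i 0 by rewrite leNgt; exact: allN.
apply: lt_le_trans (concave_segment_ge (a_concave i) (a2 i) ai t01).
by rewrite divr_gt0.
Qed.

End Convex.

Section Log.
Context {R : realType}.

(** Compares derivatives along [s |-> 1 + s z]: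
    [- z / (1 + s z) = - z + s z^2 - s^2 z^3 / (1 + s z)], where
    [1 + s z >= 3/4]. *)
Lemma ln_barrier_expansion (z : R) : - (1 / 4) <= z ->
  - ln (1 + z) <= - z + z ^+ 2 / 2 + 4 / 9 * `|z| ^+ 3.
Proof.
move=> z4.
have pos (s : R) : 0 <= s <= 1 -> 3 / 4 <= 1 + s * z.
  move=> /andP[s0 s1]; nra.
have fD (s : R) : 0 <= s <= 1 ->
    is_derive s 1 (fun s => - ln (1 + s * z)) (- (z / (1 + s * z))).
  move=> /pos s1.
  have s1' : 0 < 1 + s * z by apply: lt_le_trans s1; lra.
  have l : is_derive s 1 (fun s : R => 1 + s * z) z.
    have -> : (fun s : R => 1 + s * z) = cst 1 + (fun s : R => z * s ^+ 1).
      by apply/funext => r; rewrite !fctE expr1 mulrC.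
    apply: is_derive_eq (is_deriveD _ (is_derive_monomial z 0 s)) _.
    by rewrite add0r !mulr1.
  pose g (r : R) := 1 + r * z.
  have lnD : is_derive (g s) 1 (@ln R) (g s)^-1 by exact: is_derive1_ln.
  by have := is_deriveN (is_derive1_comp lnD l); rewrite mulrC.
pose k : R := 4 / 9 * `|z| ^+ 3.
have gD (s : R) : 0 <= s <= 1 -> is_derive s 1
   ((fun s : R => k * s ^+ 3) + (fun s : R => z ^+ 2 / 2 * s ^+ 2) +
    (fun s : R => (- z) * s ^+ 1))
   (k * 3 * s ^+ 2 + z ^+ 2 / 2 * 2 * s ^+ 1 + (- z) * 1 * s ^+ 0).
  move=> _; exact: (is_deriveD (is_deriveD (is_derive_monomial k 2 s)
    (is_derive_monomial (z ^+ 2 / 2) 1 s)) (is_derive_monomial (- z) 0 s)).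
have := growth_le ler01 fD gD.
rewrite !fctE !expr1n !expr0n /= !mulr0 ?mulr1 mul0r mul1r addr0 ln1.
rewrite !oppr0 !addr0 => H.
rewrite [leRHS]addrC [- z + _]addrC addrA.
rewrite subr0 in H; apply: H => s /andP[s0 s1].
have p := pos s; rewrite s0 s1 in p; move/(_ isT) in p.
rewrite expr0 !mulr1 lerNl ler_pdivlMr; last by lra.
have wz : - `|z| ^+ 3 <= z ^+ 3.
  by rewrite -normrX lerNl -normrN ler_norm.
have w0 : 0 <= `|z| ^+ 3 by rewrite exprn_ge0.
rewrite /k; move: (`|z| ^+ 3) wz w0 => w wz w0 {fD gD k}.
rewrite -subr_ge0; set e := (X in 0 <= X).
have -> : e = s ^+ 2 * (w * (4 / 3 * (1 + s * z) - 1) + (w + z ^+ 3)).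
  by rewrite /e; field.
rewrite mulr_ge0 ?sqr_ge0 // addr_ge0 //; last by rewrite -lerBlDl sub0r.
by rewrite mulr_ge0 // subr_ge0 -ler_pdivrMl // (le_trans _ p) //; lra.
Qed.

End Log.

(** * Derivatives of the barrier function and of the Lagrangian *)

Section Barrier.
Context {R : realType} {n q : nat}.
Variables (f : 'cV[R]_n -> R) (a : 'cV[R]_n -> 'cV[R]_q) (mu : R).
Implicit Types (x z v w : 'cV[R]_n).
Local Notation "'a[ i ]" := (fun z => a z i 0) (at level 0, i at level 10).

Hypothesis f_diff : forall z, differentiable f z.
Hypothesis f_diff2 : forall z, differentiable (grad f) z.
Hypothesis a_diff : forall i z, differentiable 'a[i] z.
Hypothesis a_diff2 : forall i z, differentiable (grad 'a[i]) z.

Lemma is_derive_along (F : 'cV[R]_n -> R) x v (l : R) :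
  is_derive (0 : R) 1 (fun s => F (x + s *: v)) l -> is_derive x v F l.
Proof.
have e : (fun h : R => h^-1 *: (F (x + (h *: 1 + 0) *: v) - F (x + 0 *: v)))
       = (fun h => h^-1 *: (F (h *: v + x) - F x)).
  apply/funext => h.
  by rewrite -[h *: 1]/(h * 1) mulr1 !(scale0r, addr0) [x + _]addrC.
by case; rewrite /derive /derivable e => ? ?; split.
Qed.

Lemma dot_delta m (u : 'cV[R]_m) j : dot u (delta_mx j 0) = u j 0.
Proof.
rewrite dotE (bigD1 j) //= mxE !eqxx mulr1 big1 ?addr0 // => i ij.
by rewrite mxE (negPf ij) mulr0.
Qed.

Lemma invmx_slack x : strictly_feasible a x ->
  invmx (slack_mx a x) = diag_mx (\row_j (a x j 0)^-1).
Proof.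
move=> x_in; set B := diag_mx _.
have AB : slack_mx a x *m B = 1%:M.
  rewrite /slack_mx /B mulmx_diag -diag_const_mx; congr diag_mx.
  by apply/rowP => j; rewrite !mxE divff // gt_eqF //; exact: x_in.
have [Au _] := mulmx1_unit AB.
by rewrite -[LHS]mulmx1 -AB mulKmx.
Qed.

Lemma dual_varE x i : strictly_feasible a x ->
  dual_var a mu x i 0 = mu / a x i 0.
Proof.
move=> x_in; rewrite /dual_var mxE invmx_slack //.
by rewrite mul_diag_mx !mxE mulr1.
Qed.

Lemma near_strictly_feasible x : strictly_feasible a x ->
  \forall z \near x, strictly_feasible a z.
Proof.
move=> x_in; have pos i : \forall z \near nbhs x, 0 < a z i 0.
  by have := differentiable_continuous (a_diff i x) => /(cvgr_gt _)/(_ 0 (x_in i)).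
exact: (@filter_forall _ _ (fun i => [set z | 0 < a z i 0]) _ _ pos).
Qed.

Lemma grad_psi x : strictly_feasible a x ->
  grad (psi_fin f a mu) x
    = grad f x - \sum_i (mu / a x i 0) *: grad 'a[i] x.
Proof.
move=> x_in; apply/colP => j; rewrite !mxE summxE.
set v := delta_mx j 0.
suff [_ ->] : is_derive x v (psi_fin f a mu)
   ('D_v f x - mu * \sum_i (a x i 0)^-1 * dot (grad 'a[i] x) v).
  congr (_ - _); rewrite big_distrr; apply: eq_bigr => i _ /=.
  by rewrite dot_delta !mxE mulrA.
apply: is_derive_along; rewrite derive_grad //.
have x0 : x + 0 *: v = x by rewrite scale0r addr0.
have fl : is_derive (0 : R) 1 (fun s => f (x + s *: v)) (dot (grad f x) v).
  by have := is_derive_line (f_diff (x + 0 *: v)); rewrite x0.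
have al i : is_derive (0 : R) 1 (fun s => ln (a (x + s *: v) i 0))
    ((a x i 0)^-1 * dot (grad 'a[i] x) v).
  have := is_derive_line (a_diff i (x + 0 *: v)); rewrite x0 => D.
  pose g (s : R) := a (x + s *: v) i 0.
  have lnD : is_derive (g 0) 1 (@ln R) (a x i 0)^-1.
    by rewrite /g x0; apply: is_derive1_ln; exact: x_in.
  exact: (is_derive1_comp lnD D).
have := is_deriveB fl (is_deriveZ mu (is_derive_sum al)).
congr (is_derive _ _ _ _); apply/funext => s.
by rewrite /psi_fin !fctE fct_sumE.
Qed.

Lemma hessE (g : 'cV[R]_n -> R) x i j :
  hess g x i j = dot (grad (fun z => grad g z i 0) x) (delta_mx j 0).
Proof. by rewrite dot_delta !mxE. Qed.

Lemma outerE m (u v : 'cV[R]_m) i j : (u *m v^T) i j = u i 0 * v j 0.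
Proof. by rewrite mxE big_ord1 mxE. Qed.

(** The Hessian of the Lagrangian at the multipliers [mu / a_i x], plus the rank-one
    terms produced by differentiating these multipliers. *)
Definition hess_barrier x : 'M[R]_n :=
  hess f x - \sum_i (mu / a x i 0) *: hess 'a[i] x
  + \sum_i (mu / a x i 0 ^+ 2) *: (grad 'a[i] x *m (grad 'a[i] x)^T).

Lemma hess_barrierE x i j :
  hess_barrier x i j = hess f x i j
    - \sum_k mu / a x k 0 * hess 'a[k] x i j
    + \sum_k mu / a x k 0 ^+ 2 * (grad 'a[k] x i 0 * grad 'a[k] x j 0).
Proof.
have sumE (A B D : 'M[R]_n) : (A - B + D) i j = A i j - B i j + D i j.
  by rewrite !mxE.
have scaleE c (A : 'M[R]_n) : (c *: A) i j = c * A i j by rewrite mxE.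
rewrite sumE !summxE; congr (_ - _ + _); apply: eq_bigr => k _.
  exact: scaleE.
by rewrite scaleE outerE.
Qed.

(** The formula of [grad_psi] holds in a neighbourhood of [x], hence can be
    differentiated there. *)
Lemma hess_psi x : strictly_feasible a x ->
  hess (psi_fin f a mu) x = hess_barrier x.
Proof.
move=> x_in; apply/matrixP => i j; rewrite hess_barrierE [LHS]mxE.
set v := delta_mx j 0.
have -> : 'D_v (fun z => grad (psi_fin f a mu) z i 0) x =
    'D_v (fun z => grad f z i 0
                   - mu * \sum_k (a z k 0)^-1 * grad 'a[k] z i 0) x.
  apply: near_eq_derive; near=> z.
  rewrite grad_psi; last by near: z; exact: near_strictly_feasible.
  rewrite [LHS]mxE; congr (_ + _).
  rewrite mxE summxE big_distrr; congr (- _); apply: eq_bigr => k _.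
  by rewrite /= mulrA [LHS]mxE.
have x0 : x + 0 *: v = x by rewrite scale0r addr0.
suff [_ ->] : is_derive x v
   (fun z => grad f z i 0 - mu * \sum_k (a z k 0)^-1 * grad 'a[k] z i 0)
   (hess f x i j - mu * \sum_k ((a x k 0)^-1 * hess 'a[k] x i j
     - (a x k 0) ^- 2 * dot (grad 'a[k] x) v * grad 'a[k] x i 0)).
  rewrite -addrA; congr (_ + _).
  rewrite big_distrr -sumrN -sumrN -big_split; apply: eq_bigr => k _ /=.
  rewrite dot_delta mulrBr opprB addrC; congr (_ + _).
    by rewrite -!mulrA [grad _ _ j 0 * _]mulrC.
  by rewrite mulrA.
apply: is_derive_along.
have fl : is_derive (0 : R) 1 (fun s => grad f (x + s *: v) i 0)
    (hess f x i j).
  rewrite hessE.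
  have := is_derive_line (differentiable_grad_coord i (f_diff2 (x + 0 *: v))).
  by rewrite x0.
have al k : is_derive (0 : R) 1
    (fun s => (a (x + s *: v) k 0)^-1 * grad 'a[k] (x + s *: v) i 0)
    ((a x k 0)^-1 * hess 'a[k] x i j
     - (a x k 0) ^- 2 * dot (grad 'a[k] x) v * grad 'a[k] x i 0).
  rewrite hessE.
  have := is_derive_line (differentiable_grad_coord i (a_diff2 k (x + 0 *: v))).
  have := is_derive_line (a_diff k (x + 0 *: v)); rewrite !x0 => aD gD.
  have ne : (fun s => a (x + s *: v) k 0) 0 != 0.
    by rewrite /= x0 gt_eqF //; exact: x_in.
  have := is_deriveM (is_deriveV ne aD) gD.
  rewrite /= x0 => D; apply: (is_derive_eq D).
  rewrite -![_ *: _]/(_ * _); ring.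
have := is_deriveB fl (is_deriveZ mu (is_derive_sum al)).
congr (is_derive _ _ _ _); apply/funext => s.
by rewrite !fctE fct_sumE.
Unshelve. all: by end_near.
Qed.

Lemma dot_grad_psi x w : strictly_feasible a x ->
  dot w (grad (psi_fin f a mu) x)
    = dot w (grad f x) - \sum_i mu / a x i 0 * dot w (grad 'a[i] x).
Proof.
move=> x_in; rewrite grad_psi // dotBr dot_sumr; congr (_ - _).
by apply: eq_bigr => i _; rewrite dotZr.
Qed.

Lemma dot_hess_psi x w u : strictly_feasible a x ->
  dot w (hess (psi_fin f a mu) x *m u)
    = dot w (hess f x *m u) - \sum_i mu / a x i 0 * dot w (hess 'a[i] x *m u)
      + \sum_i mu / a x i 0 ^+ 2 * dot u (grad 'a[i] x) * dot w (grad 'a[i] x).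
Proof.
move=> x_in; rewrite hess_psi // /hess_barrier mulmxDl mulmxBl !mulmx_suml.
rewrite dotDr dotBr !dot_sumr; congr (_ - _ + _); apply: eq_bigr => i _.
  by rewrite -scalemxAl dotZr.
rewrite -scalemxAl dotZr -[RHS]mulrA; congr (_ * _); rewrite -mulmxA.
have -> : (grad 'a[i] x)^T *m u = (dot u (grad 'a[i] x))%:M.
  by rewrite dotC [LHS]mx11_scalar.
by rewrite mul_mx_scalar dotZr.
Qed.

Lemma jacE x (u : 'cV[R]_n) i : (jac a x *m u) i 0 = dot u (grad 'a[i] x).
Proof.
by rewrite dotC dotE mxE; apply: eq_bigr => j _; rewrite !mxE.
Qed.

Lemma dual_trialE x u i : strictly_feasible a x ->
  dual_trial a mu x u i 0
    = mu / a x i 0 * (1 - dot u (grad 'a[i] x) / a x i 0).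
Proof.
move=> x_in; rewrite /dual_trial /dual_mx (invmx_slack x_in) -mulmxA.
have diagE (r : 'rV[R]_q) (v : 'cV[R]_q) j : (diag_mx r *m v) j 0 = r 0 j * v j 0.
  by rewrite mul_diag_mx mxE.
have subE (v w : 'cV[R]_q) j : (v - w) j 0 = v j 0 - w j 0 by rewrite !mxE.
rewrite subE diagE [X in X * _]mxE diagE jacE [X in _ * (X * _)]mxE dual_varE //.
by rewrite mulrBr mulr1 [_^-1 * _]mulrC.
Qed.

Lemma dot_grad_lagrangian x w (y : 'cV[R]_q) :
  dot w (grad (fun z => lagrangian f a z y) x)
    = dot w (grad f x) - \sum_i y i 0 * dot w (grad 'a[i] x).
Proof.
have -> : grad (fun z => lagrangian f a z y) x
  = grad f x - \sum_i y i 0 *: grad 'a[i] x.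
  apply/colP => j; rewrite [LHS]mxE; set v := delta_mx j 0.
  have fD : is_derive x v f ('D_v f x) by split => //; exact: diff_derivable.
  have aD i : is_derive x v (y i 0 \*: 'a[i]) (y i 0 *: 'D_v 'a[i] x).
    by apply: is_deriveZ; split => //; exact: diff_derivable.
  have [_] := is_deriveB fD (is_derive_sum aD).
  have -> : f - \sum_i (y i 0 \*: 'a[i]) = (fun z => lagrangian f a z y).
    by apply/funext => z; rewrite /lagrangian !fctE fct_sumE dotE.
  move=> ->; rewrite [RHS]mxE [X in X + _ = _]/= [X in _ = X + _]mxE.
  congr (_ + _); rewrite mxE summxE; congr (- _); apply: eq_bigr => i _.
  by rewrite [RHS]mxE; congr (_ * _); rewrite mxE.
rewrite dotBr dot_sumr; congr (_ - _).
by apply: eq_bigr => i _; rewrite dotZr.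
Qed.

End Barrier.

(** * Consequences of a small displacement *)

Section Scalar.
Context {R : realType}.
Implicit Types p r s : R.

(** The increment of a relative slack is [p + r], where the quadratic model sees
    only the linear part [p] in its square.  Replacing [(p + r)^2 / 2] by
    [p^2 / 2] costs [p r + r^2 / 2]; the rest is the cubic remainder of the logarithm. *)
Lemma barrier_term_le p r s rho : `|p| <= s -> s <= 1 / 80 ->
  `|r| <= rho -> rho <= 1 / 80 ->
  - ln (1 + (p + r)) + p + r - p ^+ 2 / 2
    <= (s + rho / 2 + 2 * rho ^+ 2) * `|r| + 2 * s * p ^+ 2.
Proof.
move=> ps s80 rrho rho80.
have z4 : - (1 / 4) <= p + r.
  by move: ps rrho; rewrite !ler_norml => /andP[? _] /andP[? _]; lra.
have := ln_barrier_expansion z4.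
set l := ln _ => H.
have pr : p * r <= s * `|r|.
  by rewrite (le_trans (ler_norm _)) // normrM ler_wpM2r.
have rr : r ^+ 2 <= rho * `|r|.
  by rewrite -real_normK ?num_real // expr2 ler_wpM2r.
have p3 : `|p| ^+ 3 <= s * p ^+ 2.
  by rewrite -[p ^+ 2]real_normK ?num_real // exprS ler_wpM2r ?exprn_ge0.
have r3 : `|r| ^+ 3 <= rho ^+ 2 * `|r|.
  by rewrite exprSr ler_wpM2r // lerXn2r ?nnegrE // (le_trans _ rrho).
have z3 : `|p + r| ^+ 3 <= 4 * (`|p| ^+ 3 + `|r| ^+ 3).
  apply: (@le_trans _ _ ((`|p| + `|r|) ^+ 3)).
    by rewrite lerXn2r ?nnegrE ?addr_ge0 // ler_normD.
  move: (normr_ge0 p) (normr_ge0 r); move: (`|p|) (`|r|) => P Q P0 Q0.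
  rewrite -subr_ge0; have -> : 4 * (P ^+ 3 + Q ^+ 3) - (P + Q) ^+ 3
     = 3 * ((P - Q) ^+ 2 * (P + Q)) by ring.
  by rewrite mulr_ge0 // mulr_ge0 ?sqr_ge0 ?addr_ge0.
have sp : 0 <= s * p ^+ 2 by rewrite mulr_ge0 ?sqr_ge0 // (le_trans _ ps).
have rr0 : 0 <= rho ^+ 2 * `|r| by rewrite mulr_ge0 ?sqr_ge0.
move: H z3; have -> : (p + r) ^+ 2 = p ^+ 2 + 2 * (p * r) + r ^+ 2 by ring.
have -> : (s + rho / 2 + 2 * rho ^+ 2) * `|r| + 2 * s * p ^+ 2
  = s * `|r| + (rho * `|r|) / 2 + 2 * (rho ^+ 2 * `|r|) + 2 * (s * p ^+ 2).
  by field.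
move: pr rr p3 r3 sp rr0; move: (p * r) (s * `|r|) (r ^+ 2) (rho * `|r|)
  (`|p| ^+ 3) (s * p ^+ 2) (`|r| ^+ 3) (rho ^+ 2 * `|r|) (`|p + r| ^+ 3)
  (p ^+ 2) => {ps s80 rrho rho80 z4} a b c d e f g h i j.
by lra.
Qed.

End Scalar.

Section ShortStep.
Context {R : realType} {n q : nat}.
Variables (f : 'cV[R]_n -> R) (a : 'cV[R]_n -> 'cV[R]_q).
Variables (L_G L_H mu kappa eta1 : R).
Local Notation "'a[ i ]" := (fun z => a z i 0) (at level 0, i at level 10).
Hypothesis prob_convex : convex_problem f a.
Hypothesis lip : lipschitz_assumption f a L_G L_H.
Hypothesis mu_gt0 : 0 < mu.
Hypothesis L_G_gt0 : 0 < L_G.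
Hypothesis L_H_gt0 : 0 < L_H.
Hypothesis kappa01 : 0 < kappa <= 1.
Hypothesis eta1_gt0 : 0 < eta1.

Let f_diff z : differentiable f z.
Proof. by have [[]] := lip. Qed.
Let f_diff2 z : differentiable (grad f) z.
Proof. by have [[]] := lip. Qed.
Let a_diff i z : differentiable 'a[i] z.
Proof. by have [_ _ _ /(_ i)[[]]] := lip. Qed.
Let a_diff2 i z : differentiable (grad 'a[i]) z.
Proof. by have [_ _ _ /(_ i)[[]]] := lip. Qed.

Variables (x : 'cV[R]_n).
Hypothesis x_in : strictly_feasible a x.

Definition multiplier_weight : R := 1 + \sum_i mu / a x i 0.
Definition relative_slope (u : 'cV[R]_n) i : R :=
  dot u (grad 'a[i] x) / a x i 0.
Local Notation E := multiplier_weight.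
Local Notation y i := (mu / a x i 0).

Lemma multiplier_ge0 i : 0 <= y i.
Proof. by rewrite divr_ge0 // ltW // x_in. Qed.

Lemma weight_ge1 : 1 <= E.
Proof. by rewrite lerDl sumr_ge0 // => i _; exact: multiplier_ge0. Qed.

Lemma multiplier_le_weight i : y i <= E.
Proof.
rewrite /E (bigD1 i) //= addrCA lerDl addr_ge0 // sumr_ge0 // => j _.
exact: multiplier_ge0.
Qed.

Lemma norm1_dual : norm1 (dual_var a mu x) = \sum_i y i.
Proof.
by apply: eq_bigr => i _; rewrite dual_varE // ger0_norm // multiplier_ge0.
Qed.

Lemma eps_weight : eps a mu x = mu * Num.sqrt E.
Proof. by rewrite /eps norm1_dual. Qed.

Variables (u : 'cV[R]_n) (s : R).
Local Notation p i := (relative_slope u i).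
(* [s ^+ 2 / 2] stands for the predicted decrease along [u] divided by [mu]. *)
Hypothesis s_ge0 : 0 <= s.
Hypothesis slopes_le : \sum_i p i ^+ 2 <= s ^+ 2.
Hypothesis length_le : eta1 * (Num.sqrt E * norm2 u) <= s ^+ 2 / 2.
Hypothesis small_LG : 8 * L_G * s ^+ 3 <= kappa * eta1 ^+ 2 * mu.
Hypothesis small_s : 80 * s <= kappa.
Hypothesis small_LH : L_H * (s ^+ 2 / 2) ^+ 2 <= kappa * eta1 ^+ 3 * mu.

Let e := Num.sqrt E.
Let e_ge1 : 1 <= e.
Proof. by rewrite -sqrtr1 ler_wsqrtr // weight_ge1. Qed.
Let e_sqr : e ^+ 2 = E.
Proof. by rewrite sqr_sqrtr // (le_trans ler01) // weight_ge1. Qed.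
Let m := norm2 u.
Let m_ge0 : 0 <= m := norm2_ge0 u.

Lemma scaled_length_le : e * m <= s ^+ 2 / (2 * eta1).
Proof.
have -> : s ^+ 2 / (2 * eta1) = (s ^+ 2 / 2) / eta1.
  by rewrite invfM mulrA.
by rewrite ler_pdivlMr // mulrC.
Qed.

(** Bounds the sum over the constraints of the nonlinear parts of the relative
    slacks: the [i]-th one is at most [L_G |u|^2 / (2 a_i x)], and [E] is at least
    the sum of the [mu / a_i x]. *)
Definition curvature : R := L_G / 2 * m ^+ 2 * E / mu.

(** By [scaled_length_le] the curvature is at most [L_G s^4 / (8 eta1^2 mu)], that
    is, [s / (64 eta1^2 mu)] times the left-hand side of [small_LG]. *)
Lemma curvature_le : curvature <= kappa * s / 64.
Proof.
rewrite /curvature -e_sqr -[_ * e ^+ 2]mulrA -exprMn ler_pdivrMr // [m * e]mulrC.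
have h : (e * m) ^+ 2 <= (s ^+ 2 / (2 * eta1)) ^+ 2.
  have em0 : 0 <= e * m by rewrite mulr_ge0 // (le_trans ler01).
  by rewrite lerXn2r ?nnegrE ?scaled_length_le // (le_trans em0 scaled_length_le).
apply: (@le_trans _ _ (L_G / 2 * (s ^+ 2 / (2 * eta1)) ^+ 2)).
  by rewrite ler_wpM2l ?divr_ge0 // ltW.
have -> : L_G / 2 * (s ^+ 2 / (2 * eta1)) ^+ 2
   = (8 * L_G * s ^+ 3) * (s / (64 * eta1 ^+ 2)).
  by field; rewrite gt_eqF.
have -> : kappa * s / 64 * mu
   = (kappa * eta1 ^+ 2 * mu) * (s / (64 * eta1 ^+ 2)).
  by field; rewrite gt_eqF.
by rewrite ler_wpM2r // divr_ge0 // mulr_ge0 ?sqr_ge0.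
Qed.

Lemma s_le80 : s <= 1 / 80.
Proof. by case/andP: kappa01 => _ k1; move: small_s; lra. Qed.

Lemma curvature_le80 : curvature <= 1 / 80.
Proof.
apply: le_trans curvature_le _; case/andP: kappa01 => k0 k1.
have : kappa * s <= 1 * (1 / 80).
  by apply: ler_pM => //; [exact: ltW|exact: s_le80].
by lra.
Qed.

Lemma slope_le i : `|p i| <= s.
Proof.
rewrite -(ler_pXn2r (ltn0Sn 1)) ?nnegrE // real_normK ?num_real //.
apply: le_trans slopes_le; rewrite (bigD1 i) //= lerDl sumr_ge0 // => j _.
exact: sqr_ge0.
Qed.

Lemma curvature_slack i : L_G / 2 * m ^+ 2 <= curvature * a x i 0.
Proof.
have ai : 0 < a x i 0 by exact: x_in.
rewrite -ler_pdivrMr // /curvature -[leRHS]mulrA ler_wpM2l //.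
  by rewrite mulr_ge0 ?sqr_ge0 // divr_ge0 // ltW.
by rewrite ler_pdivlMr // mulrC multiplier_le_weight.
Qed.

(** The relative slopes and the curvature are at most 1/80, so along the segment
    each slack keeps much more than half of its initial value. *)
Lemma segment_strictly_feasible (t : R) : 0 <= t <= 1 ->
  strictly_feasible a (x + t *: u).
Proof.
apply: strictly_feasible_segment => // [i|{}t /andP[t0 t1] seg i].
  by have [_ /(_ i)] := prob_convex.
have seg' (r : R) : 0 <= r <= 1 -> feasible a (x + r *: (t *: u)).
  move=> /andP[r0 r1]; rewrite scalerA; apply: seg.
  by rewrite mulr_ge0 // ler_piMl.
have [_ _ _ /(_ i)[_ aG _]] := lip.
have := value_taylor1 seg' (a_diff i) aG (t := 1).
rewrite ler01 lexx => /(_ isT); rewrite scale1r mul1r expr1n mulr1 norm2Z //.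
rewrite [dot _ (t *: u)]dotC [dot (t *: u) _]dotC dotZr [dot _ u]dotC.
have ai : 0 < a x i 0 by exact: x_in.
have -> : dot u (grad 'a[i] x) = p i * a x i 0.
  by rewrite /relative_slope divfK // gt_eqF.
have K := curvature_slack i.
have tu : L_G / 2 * (t * norm2 u) ^+ 2 <= L_G / 2 * m ^+ 2.
  apply: ler_wpM2l; first by rewrite divr_ge0 // ltW.
  by rewrite lerXn2r ?nnegrE ?mulr_ge0 // ler_piMl.
have Ka : curvature * a x i 0 <= (1 / 80) * a x i 0.
  by rewrite ler_wpM2r ?curvature_le80 // ltW.
have tp : `|t * (p i * a x i 0)| <= (1 / 80) * a x i 0.
  rewrite [`|t * _|]normrM [`|_ * a x i 0|]normrM (ger0_norm t0)
    (gtr0_norm ai) -[leRHS]mul1r.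
  have ai0 := ltW ai; apply: ler_pM; rewrite ?mulr_ge0 // ler_wpM2r //.
  exact: le_trans (slope_le i) s_le80.
move: tp tu Ka K ai; rewrite !ler_norml => /andP[+ _] + + + + /andP[+ _].
move: (t * (p i * _)) (curvature * _) (L_G / 2 * m ^+ 2) (_ * (t * _) ^+ 2).
move: (a x i 0) (a (x + t *: u) i 0) => A B c1 c2 c3 c4.
by move=> ? ? ? ? ?; lra.
Qed.

Definition relative_remainder i : R := (a (x + u) i 0 - a x i 0) / a x i 0 - p i.
Local Notation r i := (relative_remainder i).

Let seg (t : R) : 0 <= t <= 1 -> feasible a (x + t *: u).
Proof. by move=> /segment_strictly_feasible H i; exact/ltW/H. Qed.

Lemma end_strictly_feasible : strictly_feasible a (x + u).
Proof.
by rewrite -[u]scale1r; apply: segment_strictly_feasible; rewrite ler01 lexx.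
Qed.

Lemma slopeE i : dot u (grad 'a[i] x) = a x i 0 * p i.
Proof. by rewrite mulrC /relative_slope divfK // gt_eqF //; exact: x_in. Qed.

Lemma slack_endE i : a (x + u) i 0 = a x i 0 * (1 + (p i + r i)).
Proof.
rewrite /relative_remainder subrKC mulrDr mulr1 mulrC divfK ?subrKC //.
by rewrite gt_eqF //; exact: x_in.
Qed.

Lemma remainder_le i : `|r i| <= L_G / 2 * m ^+ 2 / a x i 0.
Proof.
have ai : 0 < a x i 0 by exact: x_in.
have [_ _ _ /(_ i)[_ aG _]] := lip.
have := value_taylor1 seg (a_diff i) aG (t := 1).
rewrite ler01 lexx => /(_ isT); rewrite scale1r mul1r expr1n mulr1.
rewrite [dot _ u]dotC slopeE slack_endE.
have -> : a x i 0 * (1 + (p i + r i)) - a x i 0 - a x i 0 * p i = r i * a x i 0.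
  by ring.
by rewrite normrM (gtr0_norm ai) ler_pdivlMr.
Qed.

Lemma remainder_le_curvature i : `|r i| <= curvature.
Proof.
apply: le_trans (remainder_le i) _.
by rewrite ler_pdivrMr ?curvature_slack //; exact: x_in.
Qed.

(** The second order Taylor remainder of [a_i] yields the cubic term, and
    [barrier_term_le] the others.  All but the last are proportional to the
    multiplier, so that they can be summed through [E]. *)
Lemma constraint_error_le i :
  - (mu * ln (1 + (p i + r i))) + y i * dot u (grad 'a[i] x)
    + 2^-1 * (y i * dot u (hess 'a[i] x *m u))
    - 2^-1 * (mu / a x i 0 ^+ 2 * dot u (grad 'a[i] x) * dot u (grad 'a[i] x))
  <= y i * (L_H / 6 * m ^+ 3
       + (s + curvature / 2 + 2 * curvature ^+ 2) * (L_G / 2 * m ^+ 2))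
     + 2 * mu * s * p i ^+ 2.
Proof.
have ai : 0 < a x i 0 by exact: x_in.
have ai0 : a x i 0 != 0 by rewrite gt_eqF.
have [_ _ _ /(_ i)[_ _ aH]] := lip.
have := value_taylor2 seg (a_diff i) (a_diff2 i) aH (t := 1).
rewrite ler01 lexx => /(_ isT); rewrite scale1r !mul1r !expr1n mulr1.
rewrite [dot _ u]dotC slopeE slack_endE => T.
have := barrier_term_le (slope_le i) s_le80 (remainder_le_curvature i)
  curvature_le80.
have : (s + curvature / 2 + 2 * curvature ^+ 2) * `|r i|
  <= (s + curvature / 2 + 2 * curvature ^+ 2) * (L_G / 2 * m ^+ 2 / a x i 0).
  have c0 : 0 <= curvature by exact: le_trans (remainder_le_curvature i).
  apply: ler_wpM2l; last exact: remainder_le.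
  by apply: addr_ge0; [rewrite addr_ge0 // divr_ge0|rewrite mulr_ge0 // sqr_ge0].
move: T; rewrite ler_norml => /andP[+ _].
move: (ln _) (dot u (_ *m u)) `|r i| => l h ar.
move: (p i) (r i) (curvature) (L_H / 6 * m ^+ 3) (L_G / 2 * m ^+ 2) => p r c M3 M2.
move=> T1 T2 T3.
have {}T1 : y i * - M3
    <= y i * (a x i 0 * (1 + (p + r)) - a x i 0 - a x i 0 * p - 1 / 2 * h).
  by rewrite ler_wpM2l // multiplier_ge0.
have {}T2 := le_trans T3 (lerD T2 (lexx _)).
rewrite -(ler_pM2l mu_gt0) in T2.
move: T1 T2.
have -> : y i * (a x i 0 * (1 + (p + r)) - a x i 0 - a x i 0 * p - 1 / 2 * h)
  = mu * r - 2^-1 * (y i * h) by field.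
have -> : mu / a x i 0 ^+ 2 * (a x i 0 * p) * (a x i 0 * p) = mu * p ^+ 2 by field.
have -> : mu / a x i 0 * (a x i 0 * p) = mu * p by field.
have -> : mu * ((s + c / 2 + 2 * c ^+ 2) * (M2 / a x i 0) + 2 * s * p ^+ 2)
  = y i * ((s + c / 2 + 2 * c ^+ 2) * M2) + 2 * mu * s * p ^+ 2 by field.
rewrite [y i * (M3 + _)]mulrDr mulrN.
have -> : mu * (- l + p + r - p ^+ 2 / 2)
  = - (mu * l) + mu * p + mu * r - 2^-1 * (mu * p ^+ 2) by field.
move: (2 * mu * s * p ^+ 2) (y i * M3) (y i * (_ * M2)) (y i * h) (mu * p ^+ 2)
  (mu * p) (mu * r) (mu * l) => b1 b2 b3 b4 b5 b6 b7 b8.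
by lra.
Qed.

(** The cube of [scaled_length_le], combined with [small_LH]. *)
Lemma cubic_length_le : L_H * (e * m) ^+ 3 <= kappa * (mu * (s ^+ 2 / 2)).
Proof.
have em0 : 0 <= e * m by rewrite mulr_ge0 // (le_trans ler01).
have h : (e * m) ^+ 3 <= (s ^+ 2 / (2 * eta1)) ^+ 3.
  by rewrite lerXn2r ?nnegrE ?scaled_length_le // (le_trans em0 scaled_length_le).
apply: (@le_trans _ _ (L_H * (s ^+ 2 / (2 * eta1)) ^+ 3)).
  by rewrite ler_wpM2l // ltW.
have -> : L_H * (s ^+ 2 / (2 * eta1)) ^+ 3
   = (L_H * (s ^+ 2 / 2) ^+ 2) * (s ^+ 2 / 2 / eta1 ^+ 3).
  by field; rewrite gt_eqF.
have -> : kappa * (mu * (s ^+ 2 / 2))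
   = (kappa * eta1 ^+ 3 * mu) * (s ^+ 2 / 2 / eta1 ^+ 3).
  by field; rewrite gt_eqF.
by rewrite ler_wpM2r // !divr_ge0 ?sqr_ge0 // exprn_ge0 // ltW.
Qed.

(** The Hessian errors, the curvature errors and the cubes of the slopes take at
    most the fractions 1/6, 3/32 and 1/20 of the right-hand side. *)
Lemma total_error_le :
  (E - 1) * (L_H / 6 * m ^+ 3
      + (s + curvature / 2 + 2 * curvature ^+ 2) * (L_G / 2 * m ^+ 2))
    + 2 * mu * s * \sum_i p i ^+ 2 + L_H / 6 * m ^+ 3
  <= kappa * (mu * (s ^+ 2 / 2)).
Proof.
have c_ge0 : 0 <= curvature.
  rewrite divr_ge0 ?(ltW mu_gt0) // mulr_ge0 ?(le_trans ler01 weight_ge1) //.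
  by rewrite mulr_ge0 ?sqr_ge0 // divr_ge0 // ltW.
have third : L_H * (m ^+ 3 * E) <= kappa * (mu * (s ^+ 2 / 2)).
  apply: le_trans cubic_length_le.
  rewrite ler_wpM2l ?(ltW L_H_gt0) // exprMn mulrC ler_wpM2r ?exprn_ge0 //.
  by rewrite -[leLHS]e_sqr [leRHS]exprSr ler_peMr ?sqr_ge0.
have slope3 : s * \sum_i p i ^+ 2 <= s ^+ 3 by rewrite exprS ler_wpM2l.
have LG0 : 0 <= L_G / 2 * m ^+ 2 by rewrite mulr_ge0 ?sqr_ge0 // divr_ge0 // ltW.
have cE : L_G / 2 * m ^+ 2 * E = mu * curvature.
  by rewrite [RHS]mulrC /curvature divfK // gt_eqF.
have cs := curvature_le; have c80 := curvature_le80; have s80 := s_le80.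
have := weight_ge1.
case/andP: kappa01 => k0 k1.
move: third slope3 LG0 cE c_ge0 cs c80 s80 small_s s_ge0 mu_gt0.
move: (curvature) (\sum_i _) (L_G / 2 * m ^+ 2) (m ^+ 3) (E).
move=> c sp M2 M3 w third slope3 M20 cE c0 cs c80 s80 ss s0 mu0 w1.
have -> : (w - 1) * (L_H / 6 * M3 + (s + c / 2 + 2 * c ^+ 2) * M2)
   + 2 * mu * s * sp + L_H / 6 * M3
   = (L_H * (M3 * w)) / 6 + (s + c / 2 + 2 * c ^+ 2) * (M2 * w - M2)
     + 2 * (mu * (s * sp)) by field.
have q0 : 0 <= s + c / 2 + 2 * c ^+ 2.
  by apply: addr_ge0; [rewrite addr_ge0 // divr_ge0|rewrite mulr_ge0 // sqr_ge0].
have h1 : (s + c / 2 + 2 * c ^+ 2) * (M2 * w - M2) <= (3 * s) * (mu * c).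
  rewrite cE; apply: ler_pM => //.
  - rewrite -cE subr_ge0; nra.
  - have : c <= s by nra.
    nra.
  - by rewrite gerBl.
have h2 : mu * (s * sp) <= mu * (s ^+ 2 * (kappa / 80)).
  rewrite ler_pM2l //; apply: le_trans slope3 _; rewrite exprSr.
  by rewrite ler_wpM2l ?sqr_ge0 //; lra.
have h3 : (3 * s) * (mu * c) <= (3 * s) * (mu * (kappa * s / 64)).
  by rewrite ler_wpM2l ?mulr_ge0 // ler_pM2l.
have -> : kappa * (mu * (s ^+ 2 / 2)) = mu * (s ^+ 2 * kappa) / 2 by field.
have t0 : 0 <= mu * (s ^+ 2 * kappa).
  by rewrite mulr_ge0 ?(ltW mu0) // mulr_ge0 ?sqr_ge0 // ltW.
move: third h1 h2 h3 t0.
have -> : kappa * (mu * (s ^+ 2 / 2)) = mu * (s ^+ 2 * kappa) / 2 by field.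
have -> : mu * (s ^+ 2 * (kappa / 80)) = mu * (s ^+ 2 * kappa) / 80 by field.
have -> : 3 * s * (mu * (kappa * s / 64)) = 3 * (mu * (s ^+ 2 * kappa)) / 64 by field.
move: (mu * (s ^+ 2 * kappa)) (L_H * _) (_ * (M2 * w - M2)) (mu * (s * sp)) (3 * s * _).
by move=> b1 b2 b3 b4 b5; lra.
Qed.

Lemma model_error_le :
  psi_fin f a mu (x + u) - psi_fin f a mu x - model f a mu x u
    <= kappa * (mu * (s ^+ 2 / 2)).
Proof.
have [_ _ fH _] := lip.
have := value_taylor2 seg f_diff f_diff2 fH (t := 1).
rewrite ler01 lexx => /(_ isT); rewrite scale1r !mul1r !expr1n mulr1.
rewrite ler_norml => /andP[_]; rewrite [dot _ u]dotC => Tf.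
have Ts := ler_sum (index_enum 'I_q) (P := xpredT)
  (fun i _ => constraint_error_le i).
rewrite /psi_fin /model [dot _ u]dotC dot_grad_psi // dot_hess_psi //.
have -> : \sum_i ln (a (x + u) i 0)
   = \sum_i ln (a x i 0) + \sum_i ln (1 + (p i + r i)).
  rewrite -big_split; apply: eq_bigr => i _ /=; have ai := x_in i.
  rewrite slack_endE lnM // posrE -(pmulr_rgt0 _ ai) -slack_endE.
  exact: end_strictly_feasible.
move: Ts; rewrite !big_split /= !sumrN -!big_distrr /= -big_distrl /=.
have -> : \sum_i y i = E - 1 by rewrite /E addrC addKr.
have combine (f1 f0 g h l l0 s1 s2 s3 w b2 b3 k : R) :
    f1 - f0 - g - 1 / 2 * h <= b3 -> w + b2 + b3 <= k ->
    - (mu * l) + s1 + 2^-1 * s2 - 2^-1 * s3 <= w + b2 ->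
    f1 - mu * (l0 + l) - (f0 - mu * l0) - (g - s1 + 2^-1 * (h - s2 + s3)) <= k.
  by rewrite mulrDr; lra.
exact: combine Tf total_error_le.
Qed.

(** In the first order expansion of [y i (1 - p i) grad a_i (x + u)], the term
    [y i p i grad a_i x] is exactly the rank-one part of [hess psi * u].  So the
    gradient of the Lagrangian at the new pair is the gradient of the quadratic
    model of the barrier, up to Taylor remainders. *)
Lemma grad_lagrangian_step_le w :
  dot w (grad (fun z => lagrangian f a z (dual_trial a mu x u)) (x + u))
  <= dot w (grad (psi_fin f a mu) x) + dot w (hess (psi_fin f a mu) x *m u)
     + (L_H / 2 * m ^+ 2 + s * (L_G * m)) * E * norm2 w.
Proof.
have [_ _ fH _] := lip.
set B := L_H / 2 * m ^+ 2 * norm2 w; set B' := s * (L_G * m) * norm2 w.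
have one01 : 0 <= (1 : R) <= 1 by rewrite ler01 lexx.
have B0 : 0 <= B by rewrite !mulr_ge0 ?sqr_ge0 ?norm2_ge0 ?divr_ge0 // ltW.
have B'0 : 0 <= B' by rewrite !mulr_ge0 ?norm2_ge0 // ltW.
have Tf := grad_taylor2 seg w f_diff2 fH one01.
have term i : - (dual_trial a mu x u i 0 * dot w (grad 'a[i] (x + u)))
    <= - (y i * dot w (grad 'a[i] x)) - y i * dot w (hess 'a[i] x *m u)
       + mu / a x i 0 ^+ 2 * dot u (grad 'a[i] x) * dot w (grad 'a[i] x)
       + y i * (B + B').
  have ai : a x i 0 != 0 by rewrite gt_eqF //; exact: x_in.
  have [_ _ _ /(_ i)[_ aG aH]] := lip.
  have := grad_taylor2 seg w (a_diff2 i) aH one01.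
  have : `|dot w (grad 'a[i] (x + u) - grad 'a[i] x)| <= norm2 w * (L_G * m).
    apply: le_trans (abs_dot_le _ _) _; rewrite ler_wpM2l ?norm2_ge0 //.
    have -> : m = norm2 (x + u - x) by rewrite addrC addKr.
    apply: aG; last by move=> j; exact/ltW/x_in.
    by move=> j; exact/ltW/end_strictly_feasible.
  rewrite dotBr scale1r mul1r expr1n mulr1 -/m -/B dual_trialE //.
  rewrite -/(relative_slope u i) slopeE => A10; rewrite ler_norml => /andP[Th _].
  move: A10 Th.
  have := slope_le i; have := multiplier_ge0 i.
  have -> : mu / a x i 0 ^+ 2 * (a x i 0 * p i) * dot w (grad 'a[i] x)
    = y i * (p i * dot w (grad 'a[i] x)) by field.
  move: (dot w (grad _ (x + u))) (dot w (grad _ x)) (dot w (_ *m _)).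
  move: (y i) (p i) => yi pi A1 A0 h yi0 pis A10 Th.
  have : pi * (A1 - A0) <= B'.
    apply: le_trans (ler_norm _) _; rewrite normrM /B' -mulrA [_ * norm2 w]mulrC.
    by apply: ler_pM.
  rewrite -subr_ge0 => Tp; rewrite -subr_ge0.
  have -> : - (yi * A0) - yi * h + yi * (pi * A0) + yi * (B + B')
      - - (yi * (1 - pi) * A1)
    = yi * ((A1 - A0 - h - - B) + (B' - pi * (A1 - A0))) by ring.
  by rewrite mulr_ge0 // addr_ge0 // subr_ge0.
have := ler_sum (index_enum 'I_q) (P := xpredT) (fun i _ => term i).
rewrite !big_split /= !sumrN -big_distrl /=.
have -> : \sum_i y i = E - 1 by rewrite /E addrC addKr.
move: Tf; rewrite scale1r mul1r expr1n mulr1 -/m -/B ler_norml => /andP[_ Tf] Ts.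
rewrite dot_grad_lagrangian // dot_grad_psi // dot_hess_psi //.
have -> : (L_H / 2 * m ^+ 2 + s * (L_G * m)) * E * norm2 w = E * (B + B').
  by rewrite /B /B'; ring.
have combine (f1 f0 h l s1 s2 s3 : R) : f1 - f0 - h <= B ->
    - l <= - s1 - s2 + s3 + (E - 1) * (B + B') ->
    f1 - l <= f0 - s1 + (h - s2 + s3) + E * (B + B').
  by rewrite mulrBl mul1r; lra.
exact: combine Tf Ts.
Qed.

(** The two summands are at most 1/2 and 1/16 of [kappa * eta1 * mu * e]. *)
Lemma residual_le :
  (L_H / 2 * m ^+ 2 + s * (L_G * m)) * E <= 5 / 8 * kappa * eta1 * (mu * e).
Proof.
have em0 : 0 <= e * m by rewrite mulr_ge0 // (le_trans ler01).
have h2 : (e * m) ^+ 2 <= (s ^+ 2 / (2 * eta1)) ^+ 2.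
  by rewrite lerXn2r ?nnegrE ?scaled_length_le // (le_trans em0 scaled_length_le).
have e0 : 0 <= e by exact: le_trans ler01 e_ge1.
have k0 : 0 < kappa by case/andP: kappa01.
have ne : eta1 != 0 by rewrite gt_eqF.
have hH : L_H * (e * m) ^+ 2 <= kappa * eta1 * mu.
  apply: (@le_trans _ _ (L_H * (s ^+ 2 / (2 * eta1)) ^+ 2)).
    by rewrite ler_wpM2l // ltW.
  have -> : L_H * (s ^+ 2 / (2 * eta1)) ^+ 2
    = L_H * (s ^+ 2 / 2) ^+ 2 / eta1 ^+ 2 by field.
  rewrite ler_pdivrMr ?exprn_gt0 //; apply: le_trans small_LH _.
  by rewrite le_eqVlt; apply/orP; left; apply/eqP; ring.
have hG : s * (L_G * (e * m)) <= kappa * eta1 * mu / 16.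
  apply: (@le_trans _ _ (s * (L_G * (s ^+ 2 / (2 * eta1))))).
    by rewrite ler_wpM2l // ler_wpM2l ?scaled_length_le // ltW.
  have -> : s * (L_G * (s ^+ 2 / (2 * eta1)))
    = (8 * L_G * s ^+ 3) / (16 * eta1) by field.
  rewrite ler_pdivrMr ?mulr_gt0 //; apply: le_trans small_LG _.
  by rewrite le_eqVlt; apply/orP; left; apply/eqP; field.
have T0 : 0 <= kappa * eta1 * mu by rewrite !mulr_ge0 // ltW.
rewrite -e_sqr.
have -> : (L_H / 2 * m ^+ 2 + s * (L_G * m)) * e ^+ 2
  = L_H * (e * m) ^+ 2 / 2 + s * (L_G * (e * m)) * e by field.
have -> : 5 / 8 * kappa * eta1 * (mu * e) = 5 / 8 * (kappa * eta1 * mu * e) by ring.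
have h3 : kappa * eta1 * mu <= kappa * eta1 * mu * e by rewrite ler_peMr.
have h4 : s * (L_G * (e * m)) * e <= kappa * eta1 * mu * e / 16.
  by rewrite [leRHS]mulrAC ler_wpM2r.
move: hH h3 h4; move: (kappa * eta1 * mu) T0 => T T0.
move: (L_H * _) (s * _ * _) (T * e) => b1 b2 b3; lra.
Qed.

(** By the Newton equation the gradient of the quadratic model at [u] is
    [- delta u], of norm at most [2 eta2 eps]; [residual_le] adds at most
    [5/8 kappa eta1 eps].  The factor [sqrt (7/8)] pays for replacing the old
    multipliers by the new ones in the tolerance. *)
Lemma full_step_SIP delta eta2 : 0 <= delta ->
  (hess (psi_fin f a mu) x + delta%:M) *m u = - grad (psi_fin f a mu) x ->
  (norm2 u * delta) / (2 * eps a mu x) <= eta2 ->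
  2 * eta2 + 5 / 8 * kappa * eta1 <= Num.sqrt (7 / 8) ->
  mu_SIP f a mu (x + u) (dual_trial a mu x u).
Proof.
move=> delta0 newton small_delta etas.
have s80 := s_le80; have c80 := curvature_le80.
have yE i : dual_trial a mu x u i 0 = y i * (1 - p i) by rewrite dual_trialE.
have p78 i : 7 / 8 <= 1 - p i.
  have := slope_le i; rewrite ler_norml => /andP[_ ps].
  by move: ps s80; move: (p i) => pi; lra.
have y_gt0 i : 0 < y i by rewrite divr_gt0 //; exact: x_in.
have e0 : 0 < e by exact: lt_le_trans ltr01 e_ge1.
have e78 : Num.sqrt (7 / 8) * e
    <= Num.sqrt (norm1 (dual_trial a mu x u) + 1).
  rewrite -sqrtrM ?divr_ge0 // ler_wsqrtr //.
  have : \sum_i 7 / 8 * y i <= norm1 (dual_trial a mu x u).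
    apply: ler_sum => i _; rewrite yE normrM (gtr0_norm (y_gt0 i)) mulrC.
    apply: ler_wpM2l; first exact: multiplier_ge0.
    exact: le_trans (p78 i) (ler_norm _).
  rewrite -big_distrr /= /E; move: (\sum_i y i) (norm1 _) => b1 b2; lra.
split.
- exact: end_strictly_feasible.
- by move=> i; rewrite yE mulr_gt0 // (lt_le_trans _ (p78 i)) // divr_gt0.
- move=> i; rewrite yE slack_endE.
  have := slope_le i; have := remainder_le_curvature i.
  have ai : a x i 0 != 0 by rewrite gt_eqF //; exact: x_in.
  move: (p i) (r i) => pi ri rc ps.
  have -> : y i * (1 - pi) * (a x i 0 * (1 + (pi + ri))) - mu
    = mu * (ri - pi * (pi + ri)) by field.
  rewrite normrM (gtr0_norm mu_gt0) ler_pM2l //.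
  have {}rc := le_trans rc c80; have {}ps := le_trans ps s80.
  move: rc ps; rewrite !ler_norml => /andP[? ?] /andP[? ?].
  by apply/andP; split; nra.
apply: norm2_le_dual => [|w]; first by rewrite mulr_ge0 ?sqrtr_ge0 // ltW.
apply: le_trans (grad_lagrangian_step_le w) _.
have -> : dot w (grad (psi_fin f a mu) x) + dot w (hess (psi_fin f a mu) x *m u)
    = - delta * dot w u.
  rewrite -[grad _ _]opprK -newton mulmxDl dotNr dotDr mul_scalar_mx dotZr.
  by rewrite opprD addrAC addNr add0r mulNr.
have hd : - delta * dot w u <= 2 * eta2 * (mu * e) * norm2 w.
  apply: (@le_trans _ _ (delta * (norm2 w * m))).
    rewrite mulNr -mulrN ler_wpM2l // -dotNr /m -(norm2N u).
    exact: dot_le.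
  rewrite mulrCA [leRHS]mulrC ler_wpM2l ?norm2_ge0 //.
  move: small_delta; rewrite eps_weight -/e -/m ler_pdivrMr ?mulr_gt0 //.
  by rewrite mulrC => H; apply: le_trans H _; rewrite mulrCA mulrA lexx.
have hr : (L_H / 2 * m ^+ 2 + s * (L_G * m)) * E * norm2 w
    <= 5 / 8 * kappa * eta1 * (mu * e) * norm2 w.
  by rewrite ler_wpM2r ?norm2_ge0 ?residual_le.
apply: le_trans (lerD hd hr) _; rewrite -!mulrDl ler_wpM2r ?norm2_ge0 //.
rewrite mulrCA ler_pM2l //; apply: le_trans e78.
by rewrite ler_wpM2r // ltW.
Qed.

End ShortStep.

(** * From the iteration budget to smallness conditions *)

Section Constants.
Context {R : realType}.
Variables (C eta1 L_G L_H mu : R).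
Hypothesis C_int : 0 < C < 1 / 2.
Hypothesis eta1_gt0 : 0 < eta1.
Hypothesis L_G_gt0 : 0 < L_G.
Hypothesis L_H_gt0 : 0 < L_H.
Hypothesis mu_gt0 : 0 < mu.

Definition leading_rate : R :=
  8 * L_G `^ (2 / 3) / ((1 - C) `^ (2 / 3) * eta1 `^ (4 / 3)) * mu `^ (- (2 / 3)).
Definition step_budget : R := leading_rate + rate_remainder C eta1 L_G L_H mu.

Let kappa_gt0 : 0 < 1 - C.
Proof. by case/andP: C_int => ? ?; lra. Qed.

Definition hessian_rate : R :=
  L_H `^ (1 / 2) / ((1 - C) `^ (1 / 2) * eta1 `^ (3 / 2)) * mu `^ (- (1 / 2)).

Lemma leading_rate_gt0 : 0 < leading_rate.
Proof. by rewrite !(mulr_gt0, divr_gt0, invr_gt0, powR_gt0). Qed.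

Lemma hessian_rate_gt0 : 0 < hessian_rate.
Proof. by rewrite !(mulr_gt0, divr_gt0, invr_gt0, powR_gt0). Qed.

Lemma powRX (b r : R) k : (b `^ r) ^+ k = b `^ (r * k%:R).
Proof. by rewrite powRrM powR_mulrn ?powR_ge0. Qed.

Lemma leading_rate_cube :
  leading_rate ^+ 3 = 512 * L_G ^+ 2 / ((1 - C) ^+ 2 * eta1 ^+ 4 * mu ^+ 2).
Proof.
rewrite /leading_rate !exprMn exprVn !exprMn !powRX.
have -> : 2 / 3 * 3%:R = 2%:R :> R by field.
have -> : 4 / 3 * 3%:R = 4%:R :> R by field.
have -> : - (2 / 3) * 3%:R = - 2%:R :> R by field.
rewrite powRN !powR_mulrn ?ltW //.
by field; rewrite !gt_eqF.
Qed.

Lemma hessian_rate_sqr :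
  hessian_rate ^+ 2 = L_H / ((1 - C) * eta1 ^+ 3 * mu).
Proof.
rewrite /hessian_rate !exprMn exprVn !exprMn !powRX.
have -> : 1 / 2 * 2%:R = 1%:R :> R by field.
have -> : 3 / 2 * 2%:R = 3%:R :> R by field.
have -> : - (1 / 2) * 2%:R = - 1%:R :> R by field.
rewrite powRN !powR_mulrn ?ltW // !expr1.
by field; rewrite !gt_eqF.
Qed.

Lemma step_budget_ge :
  leading_rate + 12800 / (1 - C) ^+ 2 + hessian_rate <= step_budget.
Proof.
have drop (l c A H M P : R) : 0 <= A * M -> 0 <= P ->
    l + c + H * M <= l + (128 + c + (A + H) * M + P).
  by rewrite mulrDl; lra.
apply: drop.
  by rewrite mulr_ge0 ?powR_ge0 // divr_ge0 ?(ltW eta1_gt0) // mulr_ge0 ?sqrtr_ge0.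
by rewrite mulr_ge0 ?powR_ge0 // divr_ge0 // mulr_ge0 ?powR_ge0.
Qed.

Lemma step_budget_gt0 : 0 < step_budget.
Proof.
apply: lt_le_trans step_budget_ge.
apply: (addr_gt0 (addr_gt0 leading_rate_gt0 _) hessian_rate_gt0).
by apply: divr_gt0; [rewrite ltr0n|rewrite exprn_gt0].
Qed.

Variable Z : R.
Hypothesis Z_ge0 : 0 <= Z.
Hypothesis Z_small : Z * step_budget <= 1.
Let s := Num.sqrt (2 * Z).

Lemma budget_rate_le r : r <= step_budget -> Z * r <= 1.
Proof. by move=> rB; apply: le_trans Z_small; rewrite ler_wpM2l. Qed.

Let budget3 : [/\ Z * leading_rate <= 1, Z * (12800 / (1 - C) ^+ 2) <= 1 &
  Z * hessian_rate <= 1].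
Proof.
have l0 := ltW leading_rate_gt0; have h0 := ltW hessian_rate_gt0.
have m0 : 0 <= 12800 / (1 - C) ^+ 2 by apply: divr_ge0; [rewrite ler0n|rewrite sqr_ge0].
have part (l c h B : R) : 0 <= l -> 0 <= c -> 0 <= h -> l + c + h <= B ->
    [/\ l <= B, c <= B & h <= B] by move=> *; split; lra.
by have [] := part _ _ _ _ l0 m0 h0 step_budget_ge; split; apply: budget_rate_le.
Qed.

Let s_sqr : s ^+ 2 = 2 * Z.
Proof. by rewrite sqr_sqrtr // mulr_ge0. Qed.

Lemma budget_s : 80 * s <= 1 - C.
Proof.
have [_ h _] := budget3.
rewrite -(@ler_pXn2r _ 2) ?nnegrE ?mulr_ge0 ?sqrtr_ge0 ?(ltW kappa_gt0) //.
rewrite exprMn s_sqr; move: h.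
rewrite mulrA ler_pdivrMr ?exprn_gt0 // mul1r; apply: le_trans.
by rewrite le_eqVlt; apply/orP; left; apply/eqP; ring.
Qed.

(** The squares of both sides are compared through the cube of the leading rate:
    [(8 L_G s^3)^2 = 512 L_G^2 Z^3] since [s^2 = 2 Z]. *)
Lemma budget_LG : 8 * L_G * s ^+ 3 <= (1 - C) * eta1 ^+ 2 * mu.
Proof.
have [h _ _] := budget3.
have rhs0 : 0 <= (1 - C) * eta1 ^+ 2 * mu by rewrite !mulr_ge0 ?sqr_ge0 // ltW.
have lhs0 : 0 <= 8 * L_G * s ^+ 3.
  by rewrite mulr_ge0 ?exprn_ge0 ?sqrtr_ge0 // mulr_ge0 // ltW.
rewrite -(@ler_pXn2r _ 2) ?nnegrE //.
have h3 : (Z * leading_rate) ^+ 3 <= 1.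
  by rewrite exprn_ile1 // mulr_ge0 // ltW // leading_rate_gt0.
move: h3; rewrite exprMn leading_rate_cube mulrA ler_pdivrMr ?mul1r; last first.
  by rewrite !mulr_gt0 ?exprn_gt0.
have -> : (8 * L_G * s ^+ 3) ^+ 2 = 64 * L_G ^+ 2 * (s ^+ 2) ^+ 3 by ring.
rewrite s_sqr => h3; apply: le_trans (le_trans h3 _).
  by rewrite le_eqVlt; apply/orP; left; apply/eqP; ring.
by rewrite le_eqVlt; apply/orP; left; apply/eqP; ring.
Qed.

Lemma budget_LH : L_H * (s ^+ 2 / 2) ^+ 2 <= (1 - C) * eta1 ^+ 3 * mu.
Proof.
have [_ _ h] := budget3.
have h2 : (Z * hessian_rate) ^+ 2 <= 1.
  by rewrite exprn_ile1 // mulr_ge0 // ltW // hessian_rate_gt0.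
move: h2; rewrite exprMn hessian_rate_sqr mulrA ler_pdivrMr ?mul1r; last first.
  by rewrite !mulr_gt0 ?exprn_gt0.
apply: le_trans; rewrite s_sqr.
by rewrite le_eqVlt; apply/orP; left; apply/eqP; field.
Qed.

End Constants.

(** * Progress of one iteration *)

Section Iteration.
Context {R : realType} {n q : nat}.
Variables (f : 'cV[R]_n -> R) (a : 'cV[R]_n -> 'cV[R]_q).
Variables (L_G L_H C gamma eta1 eta2 mu : R).
Local Notation "'a[ i ]" := (fun z => a z i 0) (at level 0, i at level 10).
Hypothesis prob_convex : convex_problem f a.
Hypothesis L_G_gt0 : 0 < L_G.
Hypothesis L_H_gt0 : 0 < L_H.
Hypothesis lip : lipschitz_assumption f a L_G L_H.
Hypothesis C_int : 0 < C < 1 / 2.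
Hypothesis gamma_int : 0 < gamma < 1.
Hypothesis eta1_gt0 : 0 < eta1.
Hypothesis etas : 2 * eta2 + 5 / 8 * (1 - C) * eta1 <= Num.sqrt (7 / 8).
Hypothesis mu_gt0 : 0 < mu.

Let f_diff z : differentiable f z.
Proof. by have [[]] := lip. Qed.
Let f_diff2 z : differentiable (grad f) z.
Proof. by have [[]] := lip. Qed.
Let a_diff i z : differentiable 'a[i] z.
Proof. by have [_ _ _ /(_ i)[[]]] := lip. Qed.
Let a_diff2 i z : differentiable (grad 'a[i]) z.
Proof. by have [_ _ _ /(_ i)[[]]] := lip. Qed.

Lemma convex_opp_hess (g : 'cV[R]_n -> R) x u : (forall z, differentiable g z) ->
  (forall z, differentiable (grad g) z) ->
  convex_function [set: 'cV[R]_n] (fun z => - g z) ->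
  dot u (hess g x *m u) <= 0.
Proof.
move=> gD g2D gc.
have gradN : grad (fun z => - g z) = (fun z => - grad g z).
  apply/funext => z; apply/colP => i; rewrite [LHS]mxE [RHS]mxE [in RHS]mxE.
  by apply: deriveN; exact: diff_derivable.
have gND z : differentiable (fun z => - g z) z by exact: differentiableN.
have gN2D : differentiable (grad (fun z => - g z)) x.
  by rewrite gradN; exact: differentiableN.
have := convex_hess_ge0 u gc gND gN2D.
have -> : hess (fun z => - g z) x = - hess g x.
  apply/matrixP => i j; rewrite [LHS]mxE [RHS]mxE [in RHS]mxE gradN.
  have -> : (fun z => (- grad g z) i 0) = - (fun z => grad g z i 0).
    by apply/funext => z; rewrite mxE.
  by apply: deriveN; exact/diff_derivable/differentiable_grad_coord.
by rewrite mulNmx dotNr oppr_ge0.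
Qed.

(** By convexity the Hessian of the Lagrangian part is positive semidefinite; the
    remaining part of the Hessian of the barrier is this sum of squares. *)
Lemma slopes_le_hess x u : strictly_feasible a x ->
  mu * \sum_i relative_slope a x u i ^+ 2
    <= dot u (hess (psi_fin f a mu) x *m u).
Proof.
move=> x_in; rewrite dot_hess_psi // big_distrr /=.
have f0 := convex_hess_ge0 u prob_convex.1 f_diff (f_diff2 x).
have a0 : \sum_i mu / a x i 0 * dot u (hess 'a[i] x *m u) <= 0.
  apply: sumr_le0 => i _; apply: mulr_ge0_le0.
    by rewrite divr_ge0 // ltW // x_in.
  by apply: convex_opp_hess => //; exact: prob_convex.2.
have -> : \sum_i mu / a x i 0 ^+ 2 * dot u (grad 'a[i] x) * dot u (grad 'a[i] x)
    = \sum_i mu * relative_slope a x u i ^+ 2.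
  apply: eq_bigr => i _; rewrite /relative_slope; field.
  by rewrite gt_eqF //; exact: x_in.
by rewrite lerDr subr_ge0 (le_trans a0).
Qed.

Lemma strictly_feasible_psi x : strictly_feasible a x ->
  psi f a mu x = (psi_fin f a mu x)%:E.
Proof. by move=> x_in; rewrite /psi; case: forallP => // -[]. Qed.

Lemma psi_lt_pinfty x : (psi f a mu x < +oo)%E -> strictly_feasible a x.
Proof. by rewrite /psi; case: forallP. Qed.

Lemma modelZ x d (t : R) : model f a mu x (t *: d)
  = t * dot d (grad (psi_fin f a mu) x)
    + t ^+ 2 / 2 * dot d (hess (psi_fin f a mu) x *m d).
Proof.
rewrite /model -scalemxAr !dotZr [dot (t *: d) _]dotC dotZr.
by rewrite [dot (grad _ _) d]dotC [dot (_ *m _) d]dotC; field.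
Qed.

Section Step.
Variables (x d : 'cV[R]_n) (delta alpha : R).
Hypothesis x_in : strictly_feasible a x.
Hypothesis dir : direction_choice f a C eta1 eta2 mu x delta d.
Local Notation D := (- model f a mu x d).
Local Notation B := (step_budget C eta1 L_G L_H mu).
Local Notation dHd := (dot d (hess (psi_fin f a mu) x *m d)).

Let eps_gt0 : 0 < eps a mu x.
Proof.
rewrite eps_weight // mulr_gt0 // sqrtr_gt0 (lt_le_trans ltr01) //.
exact: weight_ge1.
Qed.

Let slope_grad : dot d (grad (psi_fin f a mu) x) = - dHd - delta * norm2 d ^+ 2.
Proof.
have [_ newton _ _] := dir.
rewrite -[grad _ _]opprK -newton dotNr mulmxDl dotDr mul_scalar_mx dotZr.
by rewrite norm2_sqr opprD.
Qed.

Let hess_ge0 : 0 <= dHd.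
Proof.
apply: le_trans (slopes_le_hess d x_in).
by rewrite mulr_ge0 ?(ltW mu_gt0) // sumr_ge0 // => i _; exact: sqr_ge0.
Qed.

Lemma model_decreaseE : D = dHd / 2 + delta * norm2 d ^+ 2.
Proof.
by rewrite -[d in model _ _ _ _ d]scale1r modelZ slope_grad expr1n; field.
Qed.

Lemma model_decrease_scaled (t : R) : 0 <= t <= 1 ->
  t * D <= - model f a mu x (t *: d).
Proof.
have [delta0 _ _ _] := dir.
move=> /andP[t0 t1]; rewrite model_decreaseE modelZ slope_grad -subr_ge0.
set w := delta * _; set h := dHd.
have -> : - (t * (- h - w) + t ^+ 2 / 2 * h) - t * (h / 2 + w)
   = t * (1 - t) * h / 2 by field.
by rewrite divr_ge0 // mulr_ge0 // mulr_ge0 // subr_ge0.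
Qed.

Lemma model_decrease_ge : eta1 * (eps a mu x * norm2 d) <= D.
Proof.
have [_ _ quot _] := dir.
have [d0|d0] := eqVneq (norm2 d) 0.
  have : eta1 <= 0 by rewrite (le_trans quot) // d0 mulr0 invr0 mulr0.
  by rewrite leNgt eta1_gt0.
by rewrite -ler_pdivlMr // mulr_gt0 // lt_def d0 norm2_ge0.
Qed.

Lemma model_decrease_ge0 : 0 <= D.
Proof.
apply: le_trans model_decrease_ge.
by rewrite mulr_ge0 ?mulr_ge0 ?norm2_ge0 // ltW.
Qed.

Section Short.
Variable t : R.
Hypothesis t01 : 0 <= t <= 1.
Hypothesis short : t * D * B < mu.
Let Z := t * D / mu.
Let s := Num.sqrt (2 * Z).

Let Z_ge0 : 0 <= Z.
Proof.
case/andP: t01 => t0 _.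
by rewrite divr_ge0 ?(ltW mu_gt0) // mulr_ge0 // model_decrease_ge0.
Qed.

Let Z_small : Z * B <= 1.
Proof. by rewrite mulrAC ler_pdivrMr // mul1r ltW. Qed.

Let s_sqr : s ^+ 2 = 2 * Z.
Proof. by rewrite sqr_sqrtr // mulr_ge0. Qed.

Let slopes : \sum_i relative_slope a x (t *: d) i ^+ 2 <= s ^+ 2.
Proof.
case/andP: t01 => t0 t1.
have -> : \sum_i relative_slope a x (t *: d) i ^+ 2
    = t ^+ 2 * \sum_i relative_slope a x d i ^+ 2.
  rewrite big_distrr; apply: eq_bigr => i _ /=.
  by rewrite /relative_slope dotC dotZr dotC -mulrA exprMn.
rewrite s_sqr -(ler_pM2l mu_gt0) mulrCA.
have -> : mu * (2 * Z) = 2 * (t * D) by rewrite /Z; field; rewrite gt_eqF.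
apply: (@le_trans _ _ (t ^+ 2 * dHd)).
  by rewrite ler_wpM2l ?sqr_ge0 // slopes_le_hess.
have : dHd <= 2 * D.
  have [delta0 _ _ _] := dir; rewrite model_decreaseE.
  have : 0 <= delta * norm2 d ^+ 2 by rewrite mulr_ge0 ?sqr_ge0.
  by move: (delta * _) (dHd) => w h; lra.
rewrite mulrCA expr2 -mulrA; move=> h; rewrite ler_wpM2l //.
by apply: le_trans h; rewrite ler_piMl.
Qed.

Let length :
  eta1 * (Num.sqrt (multiplier_weight a mu x) * norm2 (t *: d)) <= s ^+ 2 / 2.
Proof.
case/andP: t01 => t0 t1.
rewrite s_sqr -(ler_pM2l mu_gt0) norm2Z //.
have -> : mu * (2 * Z / 2) = t * D by rewrite /Z; field; rewrite gt_eqF.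
have -> : mu * (eta1 * (Num.sqrt (multiplier_weight a mu x) * (t * norm2 d)))
   = t * (eta1 * (mu * Num.sqrt (multiplier_weight a mu x) * norm2 d)) by ring.
by rewrite -eps_weight // ler_wpM2l // model_decrease_ge.
Qed.

Let kappa01 : 0 < 1 - C <= 1.
Proof. by case/andP: C_int => ? ?; apply/andP; split; lra. Qed.

Let bLG : 8 * L_G * s ^+ 3 <= (1 - C) * eta1 ^+ 2 * mu.
Proof. exact: budget_LG Z_small. Qed.
Let bs : 80 * s <= 1 - C.
Proof. exact: budget_s Z_small. Qed.
Let bLH : L_H * (s ^+ 2 / 2) ^+ 2 <= (1 - C) * eta1 ^+ 3 * mu.
Proof. exact: budget_LH Z_small. Qed.

(** The model decreases by at least [t * D], and its error is at most the fraction
    [1 - C] of that. *)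
Lemma short_step_sufficient : sufficient_decrease f a C mu x (t *: d).
Proof.
have end_in := end_strictly_feasible prob_convex lip mu_gt0 L_G_gt0 kappa01
  eta1_gt0 x_in (sqrtr_ge0 _) slopes length bLG bs.
have err := model_error_le prob_convex lip mu_gt0 L_G_gt0 L_H_gt0 kappa01
  eta1_gt0 x_in (sqrtr_ge0 _) slopes length bLG bs bLH.
rewrite /sufficient_decrease !strictly_feasible_psi // -EFinD lee_fin.
have M := model_decrease_scaled t01.
have e2 : mu * (s ^+ 2 / 2) = t * D by rewrite s_sqr /Z; field; rewrite gt_eqF.
move: err; rewrite e2.
have : (1 - C) * (t * D) <= (1 - C) * - model f a mu x (t *: d).
  by rewrite ler_wpM2l //; case/andP: kappa01 => /ltW.
move: (t * D) (model _ _ _ _ (t *: d)) (psi_fin _ _ _ x) (psi_fin _ _ _ _).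
by move=> td M' p0 p1 h1 h2; lra.
Qed.

(** Sufficient decrease at [d] excludes the first alternative of the direction
    test, so the regularisation [delta] is small. *)
Lemma short_full_step_SIP : t = 1 ->
  mu_SIP f a mu (x + d) (dual_trial a mu x d).
Proof.
move=> t1; have [delta0 newton _ alt] := dir.
have := short_step_sufficient; rewrite t1 scale1r => suff.
case: alt => [|small]; first by rewrite /insufficient_decrease ltNge suff.
have t1d : t *: d = d by rewrite t1 scale1r.
move: slopes length; rewrite t1d => sl le.
exact: (full_step_SIP prob_convex lip mu_gt0 L_G_gt0 L_H_gt0 kappa01
  eta1_gt0 x_in (sqrtr_ge0 _) sl le bLG bs bLH delta0 newton small etas).
Qed.

End Short.

(** A short full step would have stopped the algorithm; a short step
    [min 1 (alpha / gamma)] would not have been rejected. *)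
Lemma step_progress : stepsize_choice f a C gamma mu x d alpha ->
  ~ stop_II f a mu x d (x + alpha *: d) -> gamma * mu <= alpha * D * B.
Proof.
move=> [/andP[al0 al1] suff alt] nstop; case/andP: gamma_int => g0 g1.
have D0 := model_decrease_ge0.
have B0 : 0 < B by apply: step_budget_gt0.
rewrite leNgt; apply/negP => lt.
case: alt => [alE|].
  apply: nstop; rewrite /stop_II alE scale1r.
  apply: (@short_full_step_SIP 1); rewrite ?ler01 ?lexx //.
  by rewrite -alE (lt_trans lt) // gtr_pMl.
rewrite /insufficient_decrease ltNge => /negP; apply.
have ag0 : 0 <= alpha / gamma by rewrite divr_ge0 // ltW.
apply: short_step_sufficient; first by rewrite le_min ler01 ag0 ge_min lexx.
apply: (@le_lt_trans _ _ (alpha / gamma * D * B)).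
  by rewrite ler_wpM2r ?(ltW B0) // ler_wpM2r // ge_min lexx orbT.
rewrite -(ltr_pM2l g0); apply: le_lt_trans lt.
by rewrite 2!mulrA [gamma * _]mulrC divfK // gt_eqF.
Qed.

Lemma iteration_decrease : stepsize_choice f a C gamma mu x d alpha ->
  ~ stop_II f a mu x d (x + alpha *: d) ->
  strictly_feasible a (x + alpha *: d) /\
  psi_fin f a mu (x + alpha *: d) <= psi_fin f a mu x - C * gamma * mu / B.
Proof.
move=> st nstop; have := step_progress st nstop.
case: st => [/andP[al0 al1] suff _].
have B0 : 0 < B by apply: step_budget_gt0.
move: suff; rewrite /sufficient_decrease (strictly_feasible_psi x_in) -EFinD => suff.
have next_in : strictly_feasible a (x + alpha *: d).
  by apply: psi_lt_pinfty; rewrite (le_lt_trans suff) // ltry.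
move: suff; rewrite (strictly_feasible_psi next_in) lee_fin => suff prog.
split=> //; apply: (le_trans suff); rewrite lerD2l.
have al01 : 0 <= alpha <= 1 by rewrite (ltW al0).
have M := model_decrease_scaled al01.
case/andP: C_int => C0 _.
rewrite lerNr -!mulrA -mulrN ler_pM2l // mulrA ler_pdivrMr //.
apply: (le_trans prog); rewrite ler_pM2r //.
Qed.

End Step.
End Iteration.

(** * Counting iterations *)

Lemma enteredS (R : realType) (n q : nat) (f : 'cV[R]_n -> R)
    (a : 'cV[R]_n -> 'cV[R]_q) mu (x d : nat -> 'cV[R]_n) k : (0 < k)%N ->
  entered f a mu x d k.+1 <-> [/\ entered f a mu x d k,
    ~ stop_I f a mu (x k) & ~ stop_II f a mu (x k) (d k) (x k.+1)].
Proof.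
move=> k0; split=> [H|[H nI nII] j /andP[j0]].
  have [|nI nII] := H k; first by rewrite k0 ltnSn.
  by split=> // j /andP[j0 jk]; apply: H; rewrite j0 ltnW.
rewrite ltnS leq_eqVlt => /predU1P[-> //|jk].
by apply: H; rewrite j0.
Qed.

Section Run.
Context {R : realType} {n q : nat}.
Variables (f : 'cV[R]_n -> R) (a : 'cV[R]_n -> 'cV[R]_q).
Variables (L_G L_H C gamma eta1 eta2 mu : R) (x1 : 'cV[R]_n).
Hypothesis prob_convex : convex_problem f a.
Hypothesis L_G_gt0 : 0 < L_G.
Hypothesis L_H_gt0 : 0 < L_H.
Hypothesis lip : lipschitz_assumption f a L_G L_H.
Hypothesis C_int : 0 < C < 1 / 2.
Hypothesis gamma_int : 0 < gamma < 1.
Hypothesis eta1_gt0 : 0 < eta1.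
Hypothesis etas : 2 * eta2 + 5 / 8 * (1 - C) * eta1 <= Num.sqrt (7 / 8).
Hypothesis mu_gt0 : 0 < mu.
Hypothesis x1_in : strictly_feasible a x1.
Variables (x d : nat -> 'cV[R]_n) (delta alpha : nat -> R).
Hypothesis run : is_run f a C gamma eta1 eta2 mu x1 x d delta alpha.
Local Notation B := (step_budget C eta1 L_G L_H mu).
Local Notation bound := (iteration_bound f a C gamma eta1 L_G L_H mu x1).

Lemma run_decrease k : entered f a mu x d k.+1 ->
  strictly_feasible a (x k.+1) /\
  psi_fin f a mu (x k.+1) <= psi_fin f a mu x1 - k%:R * (C * gamma * mu / B).
Proof.
have [x1E runE] := run.
elim: k => [_|k IH]; first by rewrite x1E mul0r subr0.
move=> /(enteredS _ _ _ _ _ (ltn0Sn k))[ent nI nII].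
have [x_in le] := IH ent.
have [dir st nextE] := runE _ (ltn0Sn k) ent nI.
move: nII; rewrite nextE => nII.
have [? dec] := iteration_decrease prob_convex L_G_gt0 L_H_gt0 lip C_int
  gamma_int eta1_gt0 etas mu_gt0 x_in dir st nII.
split=> //; apply: (le_trans dec).
by rewrite -natr1 mulrDl mul1r opprD addrA lerD2r.
Qed.

Lemma psi_star_le z : strictly_feasible a z ->
  (psi_star f a mu <= (psi_fin f a mu z)%:E)%E.
Proof.
move=> z_in; apply: ereal_inf_lbound; exists z.
  by move=> i; exact/ltW/z_in.
by rewrite strictly_feasible_psi.
Qed.

Let c_gt0 : 0 < C * gamma * mu.
Proof.
by case/andP: C_int => ? _; case/andP: gamma_int => ? _; rewrite !mulr_gt0.
Qed.

Let B_gt0 : 0 < B.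
Proof. exact: step_budget_gt0. Qed.

Lemma iteration_bound_fin r : psi_star f a mu = r%:E ->
  bound = (1 + (psi_fin f a mu x1 - r) / (C * gamma * mu) * B)%:E.
Proof.
move=> rE; rewrite /iteration_bound rE strictly_feasible_psi //.
by rewrite inver gt_eqF.
Qed.

Lemma iteration_bound_pinfty : psi_star f a mu = -oo%E -> bound = +oo%E.
Proof.
move=> rE; rewrite /iteration_bound rE strictly_feasible_psi // inver gt_eqF //.
rewrite /= gt0_mulye ?lte_fin ?invr_gt0 // gt0_mulye ?lte_fin //.
Qed.

Lemma entered_le_bound K : (0 < K)%N -> entered f a mu x d K ->
  (K%:R%:E <= bound)%E.
Proof.
case: K => // k _ ent; have [x_in le] := run_decrease ent.
have := psi_star_le x_in.
case rE : (psi_star f a mu) => [r| |] //; last first.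
  by rewrite iteration_bound_pinfty // leey.
rewrite lee_fin (iteration_bound_fin rE) lee_fin => /le_trans/(_ le) H.
rewrite -natr1 addrC lerD2l mulrAC ler_pdivlMr // -ler_pdivrMr //.
by rewrite -mulrA lerBrDr addrC -lerBrDr.
Qed.

(** A run that never stops would enter iterations beyond the finite bound. *)
Lemma run_terminates : (-oo < psi_star f a mu)%E ->
  exists K xr yr, [/\ (K%:R%:E <= bound)%E, returns_at f a mu x d K xr yr &
    mu_SIP f a mu xr yr].
Proof.
have := psi_star_le x1_in.
case rE : (psi_star f a mu) => [r| |] // _ _.
have [K [K0 ent nent]] : exists K, [/\ (0 < K)%N, entered f a mu x d K &
    ~ entered f a mu x d K.+1].
  apply: contrapT => never.
  have all_ent k : entered f a mu x d k.+1.
    elim: k => [j /andP[j0]|k IH]; first by rewrite ltnS leqNgt j0.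
    by apply: contrapT => nent; apply: never; exists k.+1.
  set b := 1 + (psi_fin f a mu x1 - r) / (C * gamma * mu) * B.
  have := entered_le_bound (ltn0Sn (Num.truncn b)) (all_ent (Num.truncn b)).
  rewrite (iteration_bound_fin rE) lee_fin -/b leNgt => /negP; apply.
  exact: truncnS_gt.
have bnd := entered_le_bound K0 ent.
have [sI|nI] := pselect (stop_I f a mu (x K)).
  by exists K, (x K), (dual_var a mu (x K)); split=> //; split=> //; left.
have [sII|nII] := pselect (stop_II f a mu (x K) (d K) (x K.+1)).
  exists K, (x K.+1), (dual_trial a mu (x K) (d K)); split=> //.
  by split=> //; right.
by exfalso; apply: nent; apply/enteredS.
Qed.

End Run.

Theorem theorem2 (R : realType) (n q : nat)
  (f : 'cV[R]_n -> R) (a : 'cV[R]_n -> 'cV[R]_q)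
  (L_G L_H C gamma eta1 eta2 mu : R) (x1 : 'cV[R]_n)
  (hconv : convex_problem f a)
  (hLG : 0 < L_G) (hLH : 0 < L_H)
  (hlip : lipschitz_assumption f a L_G L_H)
  (hC : 0 < C < 1 / 2) (hgamma : 0 < gamma < 1)
  (heta1 : 0 < eta1 < 1 / 2) (heta2 : eta1 < eta2 < 1 / 2)
  (heta : 2 * eta2 + 5 / 8 * (1 - C) * eta1 <= Num.sqrt (7 / 8))
  (hmu : 0 < mu) (hx1 : strictly_feasible a x1)
  (x d : nat -> 'cV[R]_n) (delta alpha : nat -> R)
  (hrun : is_run f a C gamma eta1 eta2 mu x1 x d delta alpha) :
  (forall K : nat, (0 < K)%N -> entered f a mu x d K ->
     (K%:R%:E <= iteration_bound f a C gamma eta1 L_G L_H mu x1)%E)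
  /\
  ((-oo < psi_star f a mu)%E ->
   exists (K : nat) (xr : 'cV[R]_n) (yr : 'cV[R]_q),
     [/\ (K%:R%:E <= iteration_bound f a C gamma eta1 L_G L_H mu x1)%E,
         returns_at f a mu x d K xr yr &
         mu_SIP f a mu xr yr]).
Proof.
have /andP[eta1_gt0 _] := heta1.
split=> [K|]; first exact: (entered_le_bound hconv hLG hLH hlip hC hgamma
  eta1_gt0 heta hmu hx1 hrun).
exact: (run_terminates hconv hLG hLH hlip hC hgamma eta1_gt0 heta hmu hx1 hrun).
Qed.
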